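(* Let $1\leq k\leq n$ be integers and let $G$ be an $n\times n$ Hermitian matrix. Let $R$ be a random matrix chosen uniformly at random from $SO(n)$ (i.e. distributed according to the normalized Haar measure), and let $A$ be the $k\times k$ matrix consisting of the first $k$ rows and first $k$ columns of the conjugated matrix $R\,G\,R^{T}$. Let $F_A$ be the empirical spectral distribution function of $A$, and let $F(x)=\mathbb{E}[F_A(x)]$, $x\in\mathbb{R}$, be the expected spectral distribution of $A$. Then for each $r>0$, $$\mathbb{P}\left(\|F_A-F\|_{\infty}\geq \frac{1}{\sqrt{k}}+r\right)\leq 12\sqrt{k}\,\exp\left(-r\sqrt{\frac{k}{32}}\right).$$
   Context: For a $k\times k$ Hermitian matrix $A$ with eigenvalues $\lambda_1,\dots,\lambda_k$ (counted with multiplicity), the empirical (spectral) distribution function is $F_A(x)=\frac{1}{k}\#\{i:\lambda_i\leq x\}$ for $x\in\mathbb{R}$. The norm $\|\cdot\|_\infty$ is the supremum norm over $x\in\mathbb{R}$. *)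

(* Defs.v *)
From HB Require Import structures.
From mathcomp Require Import all_boot all_order all_algebra.
From mathcomp Require Import complex.
From mathcomp Require Import all_classical all_reals all_analysis.
Import Order.TTheory GRing.Theory Num.Theory.
Import numFieldTopology.Exports numFieldNormedType.Exports.

Set Implicit Arguments.
Unset Strict Implicit.
Unset Printing Implicit Defensive.

Local Open Scope classical_set_scope.
Local Open Scope ring_scope.
Local Open Scope complex_scope.

Definition borel_mx (R : realType) (n : nat) :=
  g_sigma_algebraType (@open 'M[R]_n).

Definition special_orthogonal (R : realType) (n : nat) : set 'M[R]_n :=
  [set U | U *m U^T = 1%:M /\ \det U = 1].
Arguments special_orthogonal : clear implicits.

(* The Haar measure of the compact group SO(n), regarded as a Borel measure on
   all n x n matrices that is carried by SO(n). *)
Definition is_haar_SO (R : realType) (n : nat)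
    (mu : probability (borel_mx R n) R) : Prop :=
  mu (special_orthogonal R n) = 1%E /\
  forall U : 'M[R]_n, special_orthogonal R n U ->
  forall B : set (borel_mx R n), measurable B ->
    mu [set (U *m M : 'M[R]_n) | M in B] = mu B.

Definition eigenvalues (R : realType) (k : nat) (A : 'M[R[i]]_k) : seq R[i] :=
  sval (closed_field_poly_normal (char_poly A)).

Lemma eigenvaluesE (R : realType) (k : nat) (A : 'M[R[i]]_k) :
  char_poly A = \prod_(z <- eigenvalues A) ('X - z%:P).
Proof.
rewrite /eigenvalues; case: closed_field_poly_normal => s /= {1}->.
by rewrite (monicP (char_poly_monic A)) scale1r.
Qed.

(* In R[i], z <= x%:C means that z is real and Re z <= x; the eigenvalues of a
   Hermitian matrix are all real. *)
Definition spectral_cdf (R : realType) (k : nat) (A : 'M[R[i]]_k) (x : R) : R :=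
  (count (fun z => z <= x%:C) (eigenvalues A))%:R / k%:R.

Definition principal_submx (T : Type) (k n : nat) (kn : (k <= n)%N)
    (M : 'M[T]_n) : 'M[T]_k :=
  mxsub (widen_ord kn) (widen_ord kn) M.

Definition conjugated_mx (R : realType) (n : nat) (G : 'M[R[i]]_n)
    (U : 'M[R]_n) : 'M[R[i]]_n :=
  map_mx (real_complex R) U *m G *m (map_mx (real_complex R) U)^T.

Definition sup_norm (R : realType) (f : R -> R) : \bar R :=
  ereal_sup [set (`|f x|)%:E | x in [set: R]].

(* Main.v *)
Require Import Defs.
From HB Require Import structures.
From mathcomp Require Import all_boot all_order all_algebra.
From mathcomp Require Import ring lra zify.
From mathcomp Require Import complex.
From mathcomp Require Import all_classical all_reals all_analysis.
From mathcomp Require Import measurable_realfun.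
Import Order.TTheory GRing.Theory Num.Theory.
Import numFieldTopology.Exports numFieldNormedType.Exports.
Set Implicit Arguments.
Unset Strict Implicit.
Unset Printing Implicit Defensive.
Local Open Scope classical_set_scope.
Local Open Scope ring_scope.

(** Fix a real x and let f(S) be the value at x of the empirical spectral
distribution of the leading k x k block of S G S^T. Two properties of f make it
concentrate under Haar measure on SO(n).

First, inserting a rotation T with T - 1 of rank at most 2 somewhere in a
product, S V becoming S T V, changes the block by a matrix of rank at most 4.
Two Hermitian matrices that agree on a subspace of codimension m have eigenvalue
counting functions that differ by at most m (spectral_count_le_rank, a dimension
count in the spirit of Courant and Fischer), so f moves by at most c = 4/k.
Second, f only sees the first k rows of S, so it is invariant under left
multiplication by the subgroup H_k, where H_i is the stabilizer in SO(n) of the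
first i coordinate vectors.

Averaging f over the left action of H_k, H_(k-1), ..., H_0 = SO(n) yields a
martingale that starts at f and ends at its mean. An element of H_i is an element
of H_(i+1) times the transpose of a product of two reflections (stab_turn), so
the averages over H_(i+1) vary by at most c along H_i, and each step costs a
factor exp(2 (lam c)^2) in the exponential moment (expR_mean_le). This gives
haar_mgf_le. Haar measure on H_(i+1) is produced from Haar measure on H_i by the
map S |-> S T(S) that completes one more coordinate row (haar_step), and a
left-invariant probability is also right-invariant by Fubini (haar_right).
With lam = sqrt(k/32) the total cost over k steps is exp(1) <= 4, so either tail
of f at distance r has probability at most 4 exp(-r lam) (block_tails).

For the supremum norm, put l = ceil(sqrt k) and consider the quantiles of the
expected distribution F at the levels j/l with 0 < j < l. Monotonicity bounds the
deviation at any point by 1/l plus the largest deviation at a quantile, taken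
from the right on one side and as a left limit on the other (quantile_grid).
There are 2(l-1) <= 2 sqrt k such tails, hence the bound 8 sqrt k exp(-r lam),
which is below the stated one.

The deviation event is measurable because eigenvalue counting functions are upper
semicontinuous, by the same dimension count with m = 0, hence Borel, and because
right continuity turns the supremum over the reals into one over the rationals. *)

(** * Eigenvalue counting for Hermitian matrices *)

Lemma char_poly_similar (F : fieldType) (k : nat) (P D : 'M[F]_k) :
  P \in unitmx -> char_poly (invmx P *m D *m P) = char_poly D.
Proof.
move=> Pu; rewrite /char_poly /char_poly_mx.
set Q := map_mx polyC P; set Q' := map_mx polyC (invmx P).
have QQ : Q' *m Q = 1%:M by rewrite -map_mxM mulVmx // map_mx1.
have -> : 'X%:M - map_mx polyC (invmx P *m D *m P)
          = Q' *m ('X%:M - map_mx polyC D) *m Q.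
  rewrite !map_mxM mulmxBr mulmxBl; congr (_ - _).
  by rewrite -mulmxA -scalar_mxC mulmxA QQ mul1mx.
by rewrite !det_mulmx mulrAC -det_mulmx QQ det1 mul1r.
Qed.

Lemma mxrank_diag_mx_le (F : fieldType) (k : nat) (d : 'rV[F]_k) :
  (\rank (diag_mx d) <= #|[pred i | d ord0 i != 0%R]|)%N.
Proof.
rewrite diag_mx_sum_delta -sum1_card (bigID [pred i | d ord0 i != 0]) /=.
rewrite [X in (_ + X)%R]big1 => [|i]; last first.
  by rewrite negbK => /eqP ->; rewrite scale0r.
rewrite addr0; elim/big_ind2: _ => [|M a N b Ma Nb|i _].
- by rewrite mxrank0.
- exact: leq_trans (mxrank_add _ _) (leq_add Ma Nb).
by rewrite (leq_trans (mxrank_scale _ _)) // mxrank_delta.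
Qed.

Section hermitian_counting.
Local Open Scope sesquilinear_scope.
Variables (C : numClosedFieldType) (k : nat).
Implicit Types (A B : 'M[C]_k) (u : 'rV[C]_k).

Definition qform A u : C := (u *m A *m u^t*) 0 0.

Definition spectral_count A (x : C) : nat :=
  #|[pred i | spectral_diag A 0 i <= x]|.

Definition spectral_coord A u : 'rV[C]_k := u *m (spectralmx A)^t*.

Lemma qform_diag (d : 'rV[C]_k) u :
  qform (diag_mx d) u = \sum_i d 0 i * `|u 0 i| ^+ 2.
Proof.
rewrite /qform mxE; apply: eq_bigr => i _.
by rewrite mul_mx_diag !mxE normCK -mulrA mulrCA.
Qed.

Lemma qform1 u : qform 1%:M u = \sum_i `|u 0 i| ^+ 2.
Proof.
by rewrite -diag_const_mx qform_diag; apply: eq_bigr => i _; rewrite mxE mul1r.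
Qed.

Lemma qform_spectral A u : A \is hermsymmx ->
  qform A u = qform (diag_mx (spectral_diag A)) (spectral_coord A u).
Proof.
move=> /hermitian_normalmx /orthomx_spectralP {1}->.
rewrite /qform /spectral_coord invmx_unitary ?spectral_unitarymx //.
by rewrite trmx_mul map_mxM trmxCK !mulmxA.
Qed.

Lemma qform1_spectral A u : qform 1%:M u = qform 1%:M (spectral_coord A u).
Proof.
rewrite /qform /spectral_coord !mulmx1 trmx_mul map_mxM trmxCK.
rewrite mulmxA -[u *m _ *m _]mulmxA -invmx_unitary ?spectral_unitarymx //.
by rewrite mulVmx ?spectral_unit // mulmx1.
Qed.

Lemma spectral_coord_eq0 A u : (spectral_coord A u == 0) = (u == 0).
Proof.
rewrite /spectral_coord -invmx_unitary ?spectral_unitarymx //.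
apply/eqP/eqP => [h|->]; last by rewrite mul0mx.
by rewrite -[u](mulmxKV (spectral_unit A)) h mul0mx.
Qed.

(** The matrix D stands for its left kernel, a subspace of codimension
rank D on which B is compared with A. If the inequality failed, the span of the
eigenvectors of A with eigenvalue at most x, the span of those of B with
eigenvalue above x', and that kernel would have a common nonzero vector u, since
their codimensions add up to less than k. Then u A u^* <= x |u|^2 and
u B u^* > x' |u|^2, against the comparison on the kernel. *)
Lemma spectral_count_le_rank A B (D : 'M[C]_k) (x x' : C) :
    A \is hermsymmx -> B \is hermsymmx -> x' \is Num.real ->
    (forall u, u *m D = 0 ->
       qform B u - qform A u <= (x' - x) * qform 1%:M u) ->
  (spectral_count A x <= spectral_count B x' + \rank D)%N.
Proof.
move=> Ah Bh x'r hD; rewrite leqNgt; apply/negP => lt_count.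
pose dA : 'rV[C]_k := \row_i (~~ (spectral_diag A 0 i <= x))%R%:R.
pose dB : 'rV[C]_k := \row_i (spectral_diag B 0 i <= x')%R%:R.
(* The left kernel of M is the intersection of the three subspaces. *)
pose M := row_mx ((spectralmx A)^t* *m diag_mx dA)
            (row_mx ((spectralmx B)^t* *m diag_mx dB) D).
have rkM : (\rank M < k)%N.
  have rrow m1 m2 (M1 : 'M[C]_(k, m1)) (M2 : 'M[C]_(k, m2)) :
      (\rank (row_mx M1 M2) <= \rank M1 + \rank M2)%N.
    rewrite -mxrank_tr tr_row_mx -(mxrank_tr M1) -(mxrank_tr M2) -addsmxE.
    exact: mxrank_adds_leqif.
  have rA : (\rank ((spectralmx A)^t* *m diag_mx dA)
             <= k - spectral_count A x)%N.
    apply: (leq_trans (mxrankM_maxr _ _)).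
    apply: (leq_trans (mxrank_diag_mx_le _)).
    rewrite -[X in (_ <= X - _)%N]card_ord.
    rewrite -(cardC [pred i | spectral_diag A 0 i <= x]) /spectral_count addKn.
    apply: subset_leq_card; apply/fintype.subsetP => i; rewrite !inE mxE.
    by case: (_ <= _); rewrite //= eqxx.
  have rB : (\rank ((spectralmx B)^t* *m diag_mx dB)
             <= spectral_count B x')%N.
    apply: (leq_trans (mxrankM_maxr _ _)).
    apply: (leq_trans (mxrank_diag_mx_le _)).
    apply: subset_leq_card; apply/fintype.subsetP => i; rewrite !inE mxE.
    by case: (_ <= _); rewrite //= eqxx.
  have cA : (spectral_count A x <= k)%N.
    by rewrite -[X in (_ <= X)%N]card_ord; exact: max_card.
  apply: leq_ltn_trans (rrow _ _ _ _) _.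
  apply: leq_ltn_trans (leq_add rA (rrow _ _ _ _)) _.
  apply: leq_ltn_trans (leq_add (leqnn _) (leq_add rB (leqnn _))) _.
  by rewrite -ltn_subRL subKn.
have : kermx M != 0 by rewrite kermx_eq0 /row_free ltn_eqF.
case/rowV0Pn => u /sub_kermxP uM u0.
move: uM; rewrite mul_mx_row mul_mx_row -row_mx0 => /eq_row_mx [uA].
rewrite -row_mx0 => /eq_row_mx [uB uD].
have cA i : ~~ (spectral_diag A 0 i <= x) -> spectral_coord A u 0 i = 0.
  move=> h; have := congr1 (fun r : 'rV_k => r 0 i) uA.
  by rewrite mulmxA mul_mx_diag !mxE h mulr1.
have cB i : spectral_diag B 0 i <= x' -> spectral_coord B u 0 i = 0.
  move=> h; have := congr1 (fun r : 'rV_k => r 0 i) uB.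
  by rewrite mulmxA mul_mx_diag !mxE h mulr1.
have leA : qform A u <= x * qform 1%:M u.
  rewrite (qform_spectral u Ah) (qform1_spectral A) qform_diag qform1 mulr_sumr.
  apply: ler_sum => i _.
  have [h|/cA ->] := boolP (spectral_diag A 0 i <= x).
    by rewrite ler_wpM2r // exprn_ge0.
  by rewrite normr0 expr0n /= !mulr0.
have ltB : x' * qform 1%:M u < qform B u.
  rewrite (qform_spectral u Bh) (qform1_spectral B) qform_diag qform1 mulr_sumr.
  have realB i : spectral_diag B 0 i \is Num.real.
    by have /mxOverP := hermitian_spectral_diag_real Bh; apply.
  have [i ui] : exists i, spectral_coord B u 0 i != 0.
    apply/existsP; apply: contraNT u0; rewrite negb_exists => /forallP h.
    rewrite -(spectral_coord_eq0 B); apply/eqP/rowP => i; rewrite [RHS]mxE.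
    by apply/eqP; move: (h i); rewrite negbK.
  have le_i j : x' * `|spectral_coord B u 0 j| ^+ 2 <=
      spectral_diag B 0 j * `|spectral_coord B u 0 j| ^+ 2.
    have [h|h] := real_leP x'r (realB j).
      by rewrite ler_wpM2r // exprn_ge0.
    by rewrite (cB j (ltW h)) normr0 expr0n /= !mulr0.
  rewrite (bigD1 i) //= [ltRHS](bigD1 i) //=.
  apply: ltr_leD; last exact: ler_sum.
  have [h|h] := real_ltP x'r (realB i).
    by rewrite ltr_pM2r // exprn_gt0 // normr_gt0.
  by move: ui; rewrite (cB i h) eqxx.
have /lt_geF := lt_le_trans (ltr_leD ltB (lexx (- qform A u))) (hD u uD).
by rewrite mulrBl lerD2l lerN2 leA.
Qed.
End hermitian_counting.

Section entrywise.
Local Open Scope sesquilinear_scope.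
Variables (C : numClosedFieldType) (k : nat).
Lemma qform_real (A : 'M[C]_k) u : A \is hermsymmx -> qform A u \is Num.real.
Proof.
move=> Ah; rewrite qform_spectral // qform_diag; apply: rpred_sum => i _.
have /mxOverP sr := hermitian_spectral_diag_real Ah.
by rewrite rpredM // ger0_real // exprn_ge0.
Qed.

(** A crude operator norm bound, enough to make the counting function
semicontinuous in the entries of the matrix. *)
Lemma qform_sub_le (A B : 'M[C]_k) u : A \is hermsymmx -> B \is hermsymmx ->
  qform B u - qform A u <= (\sum_i \sum_j `|B i j - A i j|) * qform 1%:M u.
Proof.
move=> Ah Bh; apply: le_trans (real_ler_norm _) _.
  by rewrite rpredB // qform_real.
have -> : qform B u - qform A u = \sum_i \sum_j u 0 i * (B i j - A i j) * (u 0 j)^*.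
  rewrite /qform -[in RHS]exchange_big /= [(_ *m _ *m _) 0 0 in X in X - _]mxE.
  rewrite [in X in _ - X]mxE -sumrB; apply: eq_bigr => j _.
  rewrite !mxE -mulrBl -sumrB mulr_suml; apply: eq_bigr => i _.
  by rewrite -mulrBr.
apply: le_trans (ler_norm_sum _ _ _) _; rewrite mulr_suml; apply: ler_sum => i _.
apply: le_trans (ler_norm_sum _ _ _) _; rewrite mulr_suml; apply: ler_sum => j _.
have le_i l : `|u 0 l| ^+ 2 <= qform 1%:M u.
  rewrite qform1 (bigD1 l) //= lerDl sumr_ge0 //.
rewrite !normrM norm_conjC mulrAC mulrC ler_wpM2l //.
have /orP[h|h] := real_leVge (normr_real (u 0 i)) (normr_real (u 0 j)).
  by apply: le_trans (le_i j); rewrite expr2 ler_wpM2r.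
by apply: le_trans (le_i i); rewrite expr2 ler_wpM2l.
Qed.
End entrywise.

(** * Eigenvalue counts of a Hermitian matrix in terms of its spectrum *)

Section cdf.
Local Open Scope complex_scope.
Variables (R : realType) (k : nat).
Implicit Types (A B : 'M[R[i]]_k) (x y : R).

Definition eigcount A x := count (fun z => z <= x%:C) (eigenvalues A).

Lemma perm_eigenvalues A : A \is hermsymmx ->
  perm_eq (eigenvalues A) [seq spectral_diag A 0 i | i <- enum 'I_k].
Proof.
move=> Ah; apply: prod_XsubC_eq; rewrite -eigenvaluesE.
have /hermitian_normalmx /orthomx_spectralP {1}-> := Ah.
rewrite char_poly_similar ?spectral_unit // char_poly_trig ?diag_mx_is_trig //.
rewrite big_map big_enum /=; apply: eq_bigr => i _.
by rewrite mxE eqxx mulr1n.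
Qed.

Lemma eigcountE A x : A \is hermsymmx -> eigcount A x = spectral_count A x%:C.
Proof.
move=> Ah; rewrite /eigcount (permP (perm_eigenvalues Ah)) count_map.
rewrite /spectral_count -sum1_card -sum1_count big_enum_cond /=.
by apply: eq_bigl => i; rewrite inE.
Qed.

Lemma eigcount_le_rank A B x : A \is hermsymmx -> B \is hermsymmx ->
  (eigcount A x <= eigcount B x + \rank (B - A)%R)%N.
Proof.
move=> Ah Bh; rewrite !eigcountE //; apply: spectral_count_le_rank => //.
  by rewrite complex_real.
move=> u uD; rewrite subrr mul0r /qform.
have -> : u *m B = u *m A by apply/eqP; rewrite -subr_eq0 -mulmxBr uD.
by rewrite subrr.
Qed.

(** The rank 0 case of the dimension count: an entrywise small perturbation moves
each eigenvalue by a small amount. *)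
Lemma eigcount_le_near A B x y : A \is hermsymmx -> B \is hermsymmx ->
    \sum_i \sum_j `|B i j - A i j| <= (y - x)%:C ->
  (eigcount A x <= eigcount B y)%N.
Proof.
move=> Ah Bh le; rewrite !eigcountE // -[leqRHS]addn0 -(mxrank0 R[i] k k).
apply: spectral_count_le_rank => //; first by rewrite complex_real.
move=> u _; apply: le_trans (qform_sub_le _ Ah Bh) _.
by rewrite -rmorphB ler_wpM2r // qform1 sumr_ge0.
Qed.

Lemma size_eigenvalues A : size (eigenvalues A) = k.
Proof.
have := size_char_poly A; rewrite eigenvaluesE size_prod_XsubC.
by case.
Qed.

Lemma eigenvalues_real A z : A \is hermsymmx -> z \in eigenvalues A ->
  z \is Num.real.
Proof.
move=> Ah; rewrite (perm_mem (perm_eigenvalues Ah)) => /mapP[i _ ->].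
by have /mxOverP := hermitian_spectral_diag_real Ah; apply.
Qed.

End cdf.

(** * One-sided limits of eigenvalue counts *)

Section counting_limits.
Local Open Scope complex_scope.
Variable R : realType.
Implicit Types (x : R) (s : seq R[i]).

(** Counts over a finite list converge by becoming stationary, which is why the
limits below are stated as eventual equalities. *)
Lemma near_count (T : eqType) (P : nat -> pred T) (Q : pred T) (s : seq T) :
    {in s, forall z, \forall m \near \oo, P m z = Q z} ->
  \forall m \near \oo, count (P m) s = count Q s.
Proof.
elim: s => [|z s IHs] h; first exact: nearW.
have hz := h z (mem_head z s).
have hs : \forall m \near \oo, count (P m) s = count Q s.
  by apply: IHs => y ys; apply: h; rewrite inE ys orbT.
by apply: filterS2 hz hs => m /= -> ->.
Qed.

Lemma near_count_right s x : \forall m \near \oo,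
  count (fun z => z <= (x + m.+1%:R^-1)%:C) s = count (fun z => z <= x%:C) s.
Proof.
apply: near_count => z _.
have [zx|xz] := leP (complex.Re z) x.
  apply: nearW => m; rewrite !lecE /= zx; congr (_ && _).
  by rewrite (le_trans zx) // lerDl invr_ge0.
have h : 0 < complex.Re z - x by rewrite subr_gt0.
near=> m; rewrite !lecE /=; congr (_ && _).
rewrite [RHS]leNgt xz; apply/negbTE; rewrite -ltNge -ltrBrDl.
by near: m; exact: near_infty_natSinv_lt (PosNum h).
Unshelve. all: by end_near. Qed.

Lemma near_count_left s x : \forall m \near \oo,
  count (fun z => z <= (x - m.+1%:R^-1)%:C) s = count (fun z => z < x%:C) s.
Proof.
apply: near_count => z _.
have [xz|zx] := leP x (complex.Re z).
  apply: nearW => m; rewrite lecE ltcE /=; congr (_ && _).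
  rewrite [RHS]ltNge xz; apply/negbTE; rewrite -ltNge.
  by rewrite (lt_le_trans _ xz) // ltrBlDr ltrDl invr_gt0.
have h : 0 < x - complex.Re z by rewrite subr_gt0.
near=> m; rewrite lecE ltcE /= zx; congr (_ && _).
rewrite lerBrDr -lerBrDl; apply: ltW.
by near: m; exact: near_infty_natSinv_lt (PosNum h).
Unshelve. all: by end_near. Qed.

Lemma near_count_pinfty s : {in s, forall z, z \is Num.real} ->
  \forall m \near \oo, count (fun z => z <= m%:R%:C) s = size s.
Proof.
move=> sr; rewrite -count_predT; apply: near_count => z /sr /complex_realP[a ->].
near=> m; rewrite lecR /=; apply: ltW.
by near: m; exact: nbhs_infty_gtr.
Unshelve. all: by end_near. Qed.

Lemma near_count_ninfty s :
  \forall m \near \oo, count (fun z => z <= (- m%:R)%:C) s = 0%N.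
Proof.
rewrite -(count_pred0 s); apply: near_count => z _.
near=> m; rewrite lecE /=; apply/negbTE; rewrite negb_and -ltNge ltrNl.
apply/orP; right; near: m; exact: nbhs_infty_gtr.
Unshelve. all: by end_near. Qed.

End counting_limits.

(** * The leading block of a rotated Hermitian matrix *)

Lemma cvg_sumr (R : realType) (T : Type) (F : set_system T) (FF : Filter F)
    (I : finType) (f : I -> T -> R) (l : I -> R) :
    (forall i, f i x @[x --> F] --> l i) ->
  \sum_i f i x @[x --> F] --> \sum_i l i.
Proof. by move=> fl; apply: cvg_big => //; exact: add_continuous. Qed.

Section rotated_block.
Local Open Scope complex_scope.
Variables (R : realType) (k n : nat) (kn : (k <= n)%N) (G : 'M[R[i]]_n).
Hypothesis G_herm : G \is hermsymmx.
Implicit Types M : 'M[R]_n.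

Definition rotated_block M : 'M[R[i]]_k :=
  principal_submx kn (conjugated_mx G M).

Definition top_rows M : 'M[R[i]]_(k, n) :=
  rowsub (widen_ord kn) (map_mx (real_complex R) M).

Lemma rotated_blockE M : rotated_block M = top_rows M *m G *m (top_rows M)^T.
Proof.
rewrite /rotated_block /principal_submx /conjugated_mx mxsub_mul.
rewrite -mul_rowsub_mx; congr (_ *m _).
by apply/matrixP => i j; rewrite !mxE.
Qed.

Lemma rotated_block_herm M : rotated_block M \is hermsymmx.
Proof.
apply/is_hermitianmxP; rewrite expr0 scale1r rotated_blockE.
have /is_hermitianmxP := G_herm; rewrite expr0 scale1r => GE.
have Vr : map_mx Num.conj (top_rows M) = top_rows M.
  by apply/matrixP => i j; rewrite !mxE; apply: conj_Creal; rewrite complex_real.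
by rewrite !trmx_mul trmxK !map_mxM /= Vr -GE -map_trmx Vr mulmxA.
Qed.

(** Writing the block as V G V^T, the difference V' G V'^T - V G V^T is
(V' - V) G V'^T + V G (V' - V)^T, whence the factor 2. *)
Lemma mxrank_rotated_block M M' :
  (\rank (rotated_block M' - rotated_block M)%R <= (\rank (M' - M)%R).*2)%N.
Proof.
set V := top_rows M; set V' := top_rows M'.
have rV : (\rank (V' - V)%R <= \rank (M' - M)%R)%N.
  have -> : (V' - V)%R = rowsub (widen_ord kn) (map_mx (real_complex R) (M' - M)).
    by apply/matrixP => i j; rewrite !mxE rmorphB.
  by rewrite rowsubE (leq_trans (mxrankM_maxr _ _)) // mxrank_map.
rewrite !rotated_blockE -/V -/V'.
have -> : V' *m G *m V'^T - V *m G *m V^T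
          = (V' - V) *m G *m V'^T + V *m G *m (V' - V)^T.
  rewrite !mulmxBl linearB /= mulmxBr addrA; congr (_ - _).
  by rewrite subrK.
rewrite (leq_trans (mxrank_add _ _)) // -addnn leq_add //.
  by rewrite (leq_trans (mxrankM_maxl _ _)) // (leq_trans (mxrankM_maxl _ _)).
by rewrite (leq_trans (mxrankM_maxr _ _)) // mxrank_tr.
Qed.

(** A real function of M' that is visibly continuous, vanishes at M' = M, and
dominates the entrywise distance of the two blocks. *)
Definition block_dist M M' : R := \sum_(i < k) \sum_(j < k) \sum_a \sum_b
  `|M' (widen_ord kn i) a * M' (widen_ord kn j) b
    - M (widen_ord kn i) a * M (widen_ord kn j) b| * complex.Re `|G a b|.

Lemma rotated_block_dist M M' :
  \sum_i \sum_j `|rotated_block M' i j - rotated_block M i j|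
    <= (block_dist M M')%:C.
Proof.
rewrite rmorph_sum; apply: ler_sum => i _; rewrite rmorph_sum; apply: ler_sum => j _.
have E N : rotated_block N i j = \sum_a \sum_b
    (N (widen_ord kn i) a * N (widen_ord kn j) b)%:C * G a b.
  rewrite rotated_blockE mxE exchange_big /=; apply: eq_bigr => b _.
  rewrite !mxE mulr_suml; apply: eq_bigr => a _.
  by rewrite !mxE rmorphM mulrAC.
rewrite !E -sumrB rmorph_sum; apply: le_trans (ler_norm_sum _ _ _) _.
apply: ler_sum => a _; rewrite -sumrB rmorph_sum.
apply: le_trans (ler_norm_sum _ _ _) _; apply: ler_sum => b _.
rewrite -mulrBl -rmorphB normrM [leRHS]rmorphM; apply: ler_pM => //.
by rewrite normc_def /= expr0n addr0 sqrtr_sqr.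
Qed.

Lemma block_dist_continuous M : block_dist M M' @[M' --> M] --> 0.
Proof.
rewrite -[X in _ --> X](_ : block_dist M M = 0); last first.
  rewrite /block_dist big1 // => i _; rewrite big1 // => j _.
  rewrite big1 // => a _; rewrite big1 // => b _.
  by rewrite subrr normr0 mul0r.
rewrite /block_dist.
do 4!(apply: (@cvg_sumr R _ (nbhs M) (nbhs_filter M)) => ?).
apply: cvgM; last exact: cvg_cst.
apply: cvg_norm; apply: cvgB; last exact: cvg_cst.
by apply: cvgM; exact: coord_continuous.
Qed.

(** The count at x equals the count at some larger y, because the spectrum is
finite; nearby blocks have no more eigenvalues below x than this one has below
y. *)
Lemma eigcount_rotated_block_usc x (j : nat) :
  open [set M : 'M[R]_n | (eigcount (rotated_block M) x < j)%N].
Proof.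
rewrite openE => M /= ltj.
have [m mE] : exists m : nat,
    eigcount (rotated_block M) (x + m.+1%:R^-1) = eigcount (rotated_block M) x.
  by have /filter_ex := near_count_right (eigenvalues (rotated_block M)) x.
have m0 : 0 < m.+1%:R^-1 :> R by rewrite invr_gt0.
have /cvgrPdist_lt/(_ _ m0) := @block_dist_continuous M.
apply: filterS => M'; rewrite sub0r normrN => d_lt /=.
apply: leq_ltn_trans ltj; rewrite -mE; apply: eigcount_le_near.
- exact: rotated_block_herm.
- exact: rotated_block_herm.
rewrite [x + _]addrC addrK; have := rotated_block_dist M' M.
move=> /le_trans; apply; rewrite lecR ltW // (le_lt_trans (ler_norm _)) //.
rewrite (_ : block_dist M' M = block_dist M M') //.
do 4!(apply: eq_bigr => ? _).
by rewrite distrC.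
Qed.

(** A count bounded by k is the sum over j < k of the indicators that it exceeds
j, and these events are complements of open sets. *)
Lemma measurable_eigcount x :
  measurable_fun setT (fun M : borel_mx R n => (eigcount (rotated_block M) x)%:R : R).
Proof.
have -> : (fun M : borel_mx R n => (eigcount (rotated_block M) x)%:R : R) =
    \sum_(j < k) (fun M : borel_mx R n =>
       \1_[set M : borel_mx R n | ~ (eigcount (rotated_block M) x < j.+1)%N] M : R).
  apply/funext => M; rewrite fct_sumE.
  have lek : (eigcount (rotated_block M) x <= k)%N.
    by rewrite -{2}(size_eigenvalues (rotated_block M)) count_size.
  transitivity (\sum_(j < k) (j < eigcount (rotated_block M) x)%N%:R : R).
    rewrite -natr_sum; congr _%:R; rewrite -(big_mkord xpredT (fun j => (j < _)%N : nat)).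
    set c := eigcount _ _ in lek *; rewrite (big_cat_nat (leq0n _) lek) /=.
    have -> : (\sum_(0 <= j < c) (j < c) = c)%N.
      rewrite -[RHS]muln1 -[X in (_ = X * _)%N]subn0 -sum_nat_const_nat.
      by apply: eq_big_nat => j /andP[_ ->].
    have -> : (\sum_(c <= j < k) (j < c) = 0)%N.
      by rewrite big_nat big1 // => j /andP[h _]; rewrite ltnNge h.
    by rewrite addn0.
  apply: eq_bigr => j _; rewrite indicE; congr (_%:R); congr nat_of_bool.
  apply/idP/idP; first by move=> h; rewrite inE /= ltnS leqNgt h.
  by rewrite inE /= ltnS leqNgt => /negP; rewrite negbK.
rewrite fct_sumE; apply: measurable_sum => j.
apply: measurable_indic; apply: (@measurableC _ (borel_mx R n) [set M | _]).
by apply: sub_sigma_algebra; exact: eigcount_rotated_block_usc.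
Qed.

End rotated_block.

(** * Borel measurability of matrix-valued maps *)

Section measurable_matrices.
Variable R : realType.

Section coordinates.
Variable n : nat.

Lemma measurable_mx_coord (i j : 'I_n) :
  measurable_fun setT (fun M : borel_mx R n => (M : 'M[R]_n) i j).
Proof.
apply: (measurability _ (RGenOInfty.measurableE R)) => //.
move=> /= _ [_ [a ->] <-]; rewrite setTI; apply: sub_sigma_algebra.
apply: (@open_comp 'M[R]_n R (fun M : 'M[R]_n => M i j)) => [M _|].
  exact: coord_continuous.
exact: interval_open.
Qed.

(** Every open set of matrices is the union of the countably many boxes with
rational centre and radius 1/(N+1) that it contains, so the Borel sets are
generated by the entries. *)
Lemma measurable_to_borel_mx d (T : measurableType d) (h : T -> borel_mx R n) :
    (forall i j, measurable_fun setT (fun t => (h t : 'M[R]_n) i j)) ->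
  measurable_fun setT h.
Proof.
move=> mh; apply: (@measurability _ _ _ _ _ h (@open 'M[R]_n)) => //.
move=> _ [U oU <-]; rewrite setTI.
pose box (c : 'M[rat]_n * nat) : set 'M[R]_n :=
  [set M | forall i j, `|M i j - ratr (c.1 i j)| < c.2.+1%:R^-1].
have -> : h @^-1` U = \bigcup_(c in [set c | box c `<=` U]) (h @^-1` box c).
  apply/seteqP; split => [t /= Ut|t [c cU] ct]; last exact: cU ct.
  have /nbhs_ballP[e /= e0 eU] : nbhs (h t : 'M[R]_n) U by apply: open_nbhs_nbhs.
  have e20 : 0 < e / 2 by rewrite divr_gt0.
  have [N Ne] : exists N : nat, N.+1%:R^-1 < e / 2.
    by have /filter_ex := near_infty_natSinv_lt (PosNum e20).
  have q_ex i j : {q : rat | `|(h t : 'M[R]_n) i j - ratr q| < N.+1%:R^-1}.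
    apply/cid; have N0 : 0 < N.+1%:R^-1 :> R by rewrite invr_gt0.
    have : (h t : 'M[R]_n) i j - N.+1%:R^-1 < (h t : 'M[R]_n) i j + N.+1%:R^-1.
      by rewrite ltrD2l gtrN.
    move=> /rat_in_itvoo[q]; rewrite in_itv /= => /andP[q1 q2]; exists q.
    by rewrite distrC ltr_distl q1 q2.
  exists (\matrix_(i, j) sval (q_ex i j), N) => /=.
    move=> M Mbox; apply: eU; split => // i j; rewrite /ball /=.
    have := Mbox i j; rewrite /= !mxE; have := svalP (q_ex i j).
    set q : R := ratr _ => hq Mq.
    rewrite (_ : _ - _ = (h t i j - q) - (M i j - q)); last by rewrite opprB addrA subrK.
    apply: le_lt_trans (ler_normB _ _) _; rewrite [e]splitr.
    by apply: ltrD; [exact: lt_trans hq Ne|exact: lt_trans Mq Ne].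
  by move=> i j /=; rewrite mxE; exact: svalP (q_ex i j).
rewrite bigcup_mkcond; apply: countable_bigcupT_measurable => [|c].
  exact: countableP.
case: ifP => // _.
rewrite (_ : _ @^-1` _ = \bigcap_(i in setT) \bigcap_(j in setT)
    [set t | `|(h t : 'M[R]_n) i j - ratr (c.1 i j)| < c.2.+1%:R^-1]); last first.
  by apply/seteqP; split => [t bt i _ j _|t bt i j]; [exact: bt|exact: bt].
apply: fin_bigcap_measurable => // i _; apply: fin_bigcap_measurable => // j _.
rewrite -[X in measurable X]setTI.
apply: (@measurable_fun_ltr _ _ _ setT
  (fun t => `|(h t : 'M[R]_n) i j - ratr (c.1 i j)|) (cst _)) => //.
apply: measurableT_comp => //; apply: measurable_funB => //.
Qed.

End coordinates.

Section matrix_operations.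
Variables (d : measure_display) (T : measurableType d).

Definition mx_measurable (m n : nat) (f : T -> 'M[R]_(m, n)) :=
  forall i j, measurable_fun setT (fun t => f t i j).

Lemma mx_measurable_cst m n (M : 'M[R]_(m, n)) : mx_measurable (fun=> M).
Proof. by move=> i j; exact: measurable_cst. Qed.

Lemma mx_measurable_tr m n (f : T -> 'M[R]_(m, n)) :
  mx_measurable f -> mx_measurable (fun t => (f t)^T).
Proof. by move=> mf i j; under eq_fun do rewrite mxE; exact: mf. Qed.

Lemma mx_measurable_row m n (f : T -> 'M[R]_(m, n)) i :
  mx_measurable f -> mx_measurable (fun t => row i (f t)).
Proof. by move=> mf i' j; under eq_fun do rewrite mxE; exact: mf. Qed.

Lemma mx_measurable_mul m n p (f : T -> 'M[R]_(m, n)) (g : T -> 'M[R]_(n, p)) :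
  mx_measurable f -> mx_measurable g -> mx_measurable (fun t => f t *m g t).
Proof.
move=> mf mg i j; under eq_fun do rewrite mxE.
by apply: measurable_sum => l; apply: measurable_funM; [exact: mf|exact: mg].
Qed.

Lemma mx_measurable_sub m n (f g : T -> 'M[R]_(m, n)) :
  mx_measurable f -> mx_measurable g -> mx_measurable (fun t => f t - g t).
Proof.
move=> mf mg i j; under eq_fun do rewrite !mxE.
by apply: measurable_funB; [exact: mf|exact: mg].
Qed.

Lemma mx_measurable_scale m n (a : T -> R) (f : T -> 'M[R]_(m, n)) :
  measurable_fun setT a -> mx_measurable f -> mx_measurable (fun t => a t *: f t).
Proof.
move=> ma mf i j; under eq_fun do rewrite mxE.
by apply: measurable_funM; [exact: ma|exact: mf].
Qed.

Lemma measurable_det n (f : T -> 'M[R]_n) :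
  mx_measurable f -> measurable_fun setT (fun t => \det (f t)).
Proof.
move=> mf; apply: measurable_sum => s; apply: measurable_funM => //.
by apply: measurable_prod => i _; exact: mf.
Qed.

Lemma measurable_to_borelP n (h : T -> borel_mx R n) :
  mx_measurable (h : T -> 'M[R]_n) <-> measurable_fun setT h.
Proof.
split; first exact: measurable_to_borel_mx.
by move=> mh i j; apply: (measurableT_comp (measurable_mx_coord i j) mh).
Qed.

(** The inverse of 0 is 0, and so is the real power 0 `^ (-1): the identification
with a power function holds on all nonnegative reals. *)
Lemma measurable_inv_ge0 (f : T -> R) : (forall t, 0 <= f t) ->
  measurable_fun setT f -> measurable_fun setT (fun t => (f t)^-1).
Proof.
move=> f0 mf; under eq_fun do rewrite -powR_inv1 //.
exact: measurableT_comp (measurable_powR _) mf.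
Qed.

End matrix_operations.

End measurable_matrices.

(** * Stabilizers of coordinate vectors in the special orthogonal group *)

Section stabilizers.
Variables (R : realType) (n : nat).
Implicit Types (S T : 'M[R]_n) (v w : 'rV[R]_n).

Local Notation SO := (special_orthogonal R n).

Lemma SO_one : SO 1%:M.
Proof. by split; rewrite ?trmx1 ?mulmx1 ?det1. Qed.

Lemma SO_mul S T : SO S -> SO T -> SO (S *m T).
Proof.
move=> [SS dS] [TT dT]; split; last by rewrite det_mulmx dS dT mulr1.
by rewrite trmx_mul mulmxA -(mulmxA S) TT mulmx1.
Qed.

Lemma SO_tr S : SO S -> SO S^T.
Proof. by move=> [SS dS]; split; rewrite ?trmxK ?det_tr //; exact: mulmx1C. Qed.

(** The condition says that S fixes the first m coordinate row vectors; a rotation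
then fixes the corresponding column vectors as well. The sets decrease in m, from
SO(n) at m = 0. *)
Definition stab (m : nat) : set 'M[R]_n :=
  [set S | SO S /\ forall i : 'I_n, (i < m)%N -> row i S = row i 1%:M].

Lemma stab_SO m S : stab m S -> SO S. Proof. by case. Qed.

Lemma stab0 S : SO S -> stab 0 S. Proof. by split. Qed.

Lemma stab_anti m p S : (m <= p)%N -> stab p S -> stab m S.
Proof. by move=> mp [SOS rS]; split => // i im; apply: rS; exact: leq_trans mp. Qed.

Lemma stab_mul m S T : stab m S -> stab m T -> stab m (S *m T).
Proof.
move=> [SOS rS] [SOT rT]; split; first exact: SO_mul.
by move=> i im; rewrite row_mul rS // -row_mul mul1mx rT.
Qed.

Lemma stab_tr m S : stab m S -> stab m S^T.
Proof.
move=> [SOS rS]; split; first exact: SO_tr.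
move=> i im; have [SS _] := SOS.
by rewrite -[S^T]mul1mx row_mul -rS // -row_mul SS rS.
Qed.

(** For v = 0 the inverse of 0 is 0 and this is the identity, so that the lemmas
below need no case distinction. *)
Definition householder v : 'M[R]_n :=
  1%:M - (2 / (v *m v^T) 0 0) *: (v^T *m v).

Lemma mulmx_householder m (u : 'M[R]_(m, n)) v :
  u *m householder v = u - (2 / (v *m v^T) 0 0) *: (u *m v^T *m v).
Proof. by rewrite /householder mulmxBr mulmx1 -scalemxAr mulmxA. Qed.

Lemma householder_tr v : (householder v)^T = householder v.
Proof.
by rewrite /householder linearB linearZ /= trmx1 trmx_mul trmxK.
Qed.

Lemma householder_orthogonal v : householder v *m (householder v)^T = 1%:M.
Proof.
rewrite householder_tr mulmx_householder.
set s := (v *m v^T) 0 0; set c := 2 / s.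
have -> : householder v *m v^T = (1 - c * s) *: v^T.
  rewrite /householder -/s -/c mulmxBl mul1mx -scalemxAl -mulmxA.
  by rewrite [v *m v^T]mx11_scalar mul_mx_scalar -/s scalerA [RHS]scalerBl scale1r.
rewrite -scalemxAl scalerA /householder -/s -/c -addrA -opprD -scalerDl.
suff -> : c + c * (1 - c * s) = 0 by rewrite scale0r subr0.
rewrite /c; have [->|s0] := eqVneq s 0; first by rewrite invr0 !(mulr0, mul0r) addr0.
by field.
Qed.

(** A reflection in coordinate l when a = -1; it repairs the determinant of
another orthogonal matrix without touching the coordinates before l. *)
Definition det_fix (l : 'I_n) (a : R) : 'M[R]_n :=
  diag_mx (\row_j if j == l then a else 1).

Lemma det_det_fix l a : \det (det_fix l a) = a.
Proof.
rewrite /det_fix det_diag (bigD1 l) //= mxE eqxx big1 ?mulr1 // => i il.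
by rewrite mxE (negbTE il).
Qed.

Lemma row_det_fix i l a : i != l -> row i 1%:M *m det_fix l a = row i 1%:M.
Proof.
move=> il; rewrite -row_mul mul1mx; apply/rowP => j.
by rewrite !mxE (negbTE il).
Qed.

Lemma mxrank_det_fix l a : (\rank (det_fix l a - 1%:M)%R <= 1)%N.
Proof.
have -> : det_fix l a - 1%:M = (a - 1) *: delta_mx l l.
  apply/matrixP => i j; rewrite !mxE -mulrnBl.
  have [<-|ij] := eqVneq i j; last first.
    rewrite mulr0n; have [il|_] := eqVneq i l; last by rewrite mulr0.
    by rewrite -il eq_sym (negbTE ij) mulr0.
  by have [_|_] := eqVneq i l; rewrite /= ?mulr1 ?mulr0 ?subrr.
by rewrite (leq_trans (mxrank_scale _ _)) // mxrank_delta.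
Qed.

(** For a unit vector w, the reflection that exchanges w and the i-th coordinate
vector, corrected in coordinate l so as to be a rotation. The formula makes sense,
and depends measurably on w, for all w. *)
Definition turn (i l : 'I_n) w : 'M[R]_n :=
  let H := householder (w - row i 1%:M) in H *m det_fix l (\det H).

Lemma SO_turn i l w : SO (turn i l w).
Proof.
rewrite /turn; set H := householder _.
have HH : H *m H^T = 1%:M by exact: householder_orthogonal.
have dH : \det H * \det H = 1 by rewrite -{2}(det_tr H) -det_mulmx HH det1.
split; last by rewrite det_mulmx det_det_fix.
rewrite trmx_mul mulmxA -(mulmxA H).
have -> : det_fix l (\det H) *m (det_fix l (\det H))^T = 1%:M.
  rewrite tr_diag_mx mulmx_diag -diag_const_mx; congr diag_mx.
  by apply/rowP => j; rewrite !mxE; case: ifP => _; rewrite ?mulr1.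
by rewrite mulmx1.
Qed.

Lemma mxrank_turn i l w : (\rank (turn i l w - 1%:M)%R <= 2)%N.
Proof.
rewrite /turn; set H := householder _; set D := det_fix _ _.
have -> : H *m D - 1%:M = (H - 1%:M) *m D + (D - 1%:M).
  by rewrite [in RHS]mulmxBl mul1mx addrA subrK.
rewrite (leq_trans (mxrank_add _ _)) // -[2%N]addn1 leq_add ?mxrank_det_fix //.
rewrite (leq_trans (mxrankM_maxl _ _)) // /H /householder addrC addKr.
rewrite mxrank_opp (leq_trans (mxrank_scale _ _)) //.
by rewrite (leq_trans (mxrankM_maxr _ _)) // rank_leq_row.
Qed.

(** The reflection sends row i of S to the i-th coordinate vector. It fixes the
earlier coordinate vectors, because S in the stabilizer has row i orthogonal to
them, and the correction acts on a coordinate l > i. *)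
Lemma stab_turn (i l : 'I_n) S : (i < l)%N -> stab i S ->
  stab i.+1 (S *m turn i l (row i S)).
Proof.
move=> il Si; have [SOS rS] := Si; split; first exact: SO_mul (SO_turn _ _ _).
move=> a; rewrite ltnS => ai.
rewrite row_mul /turn; set v := row i S - _; rewrite mulmxA.
suff -> : row a S *m householder v = row a 1%:M.
  by rewrite row_det_fix // -val_eqE /= ltn_eqF // (leq_ltn_trans ai).
have [SS _] := SOS.
have dot11 (u u' : 'rV[R]_n) : (u *m u'^T) 0 0 = \sum_j u 0 j * u' 0 j.
  by rewrite mxE; apply: eq_bigr => j _; rewrite mxE.
have dot1 (u : 'rV[R]_n) b : (u *m (row b (1%:M : 'M[R]_n))^T) 0 0 = u 0 b.
  rewrite dot11 (bigD1 b) //= !mxE eqxx mulr1 big1 ?addr0 // => j jb.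
  by rewrite !mxE eq_sym (negbTE jb) mulr0.
have dotS b c : (row b S *m (row c S)^T) 0 0 = (b == c)%:R.
  have := congr1 (fun M : 'M[R]_n => M b c) SS; rewrite !mxE => <-.
  by apply: eq_bigr => j _; rewrite !mxE.
rewrite mulmx_householder.
rewrite [row a S *m v^T]mx11_scalar mul_scalar_mx scalerA.
have dv (u : 'rV[R]_n) : (u *m v^T) 0 0 = (u *m (row i S)^T) 0 0 - u 0 i.
  by rewrite /v linearB mulmxBr mxE [X in _ + X]mxE dot1.
move: ai; rewrite leq_eqVlt => /orP[/eqP/val_inj ->|ai]; last first.
  have ia : a != i by rewrite -val_eqE /= ltn_eqF.
  rewrite (dv (row a S)) dotS (negbTE ia) rS // !mxE (negbTE ia) subrr mulr0 scale0r.
  by rewrite subr0.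
have wv : (row i S *m v^T) 0 0 = 1 - S i i.
  by rewrite dv dotS eqxx mxE.
have vv : (v *m v^T) 0 0 = 2 * (1 - S i i).
  rewrite dv (_ : (v *m _) 0 0 = 1 - S i i); last first.
    by rewrite -wv !dot11; apply: eq_bigr => j _; rewrite mulrC.
  by rewrite /v !mxE eqxx mulr1n; ring.
rewrite wv vv; have [Si1|Si1] := eqVneq (S i i) 1; last first.
  have Si2 : 1 - S i i != 0 by rewrite subr_eq0 eq_sym.
  suff -> : 2 / (2 * (1 - S i i)) * (1 - S i i) = 1 by rewrite scale1r subKr.
  by field.
(* Here row i of S is a unit vector with i-th entry 1. *)
have v0 : v = 0.
  apply/rowP => j; rewrite [RHS]mxE.
  move/eqP: vv; rewrite Si1 subrr mulr0 dot11 psumr_eq0 => [|l' _].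
    move=> /allP/(_ j); rewrite mem_index_enum => /(_ isT) /=.
    by rewrite mulf_eq0 orbb => /eqP.
  by rewrite -expr2 sqr_ge0.
by rewrite v0 scaler0 subr0; apply/eqP; rewrite -subr_eq0 -/v v0.
Qed.

End stabilizers.

(** * Means of functions with values in the unit interval *)

(** From exp(x) = exp(x/2)^2 and exp(-x/2) >= 1 - x/2 > 0 one gets
exp(x) <= (1 - x/2)^-2, a rational function that is easy to compare. *)
Lemma expR_le_quadratic (R : realType) (x : R) : x <= 1 ->
  expR x <= 1 + x + 2 * x ^+ 2.
Proof.
move=> x1; have x2 : 0 < 1 - x / 2 by lra.
have e2 : expR x * (1 - x / 2) ^+ 2 <= 1.
  rewrite -ler_pdivlMr ?exprn_gt0 // mul1r -exprVn.
  have -> : expR x = expR (x / 2) ^+ 2 by rewrite expr2 -expRD -splitr.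
  rewrite ler_sqr ?nnegrE ?expR_ge0 ?invr_ge0 ?(ltW x2) //.
  have := expR_ge1Dx (- (x / 2)); rewrite expRN => h.
  by rewrite -[leLHS]invrK lef_pV2 ?posrE ?invr_gt0 ?expR_gt0 //.
have e1 : 1 <= (1 + x + 2 * x ^+ 2) * (1 - x / 2) ^+ 2.
  have -> : (1 + x + 2 * x ^+ 2) * (1 - x / 2) ^+ 2
    = 1 + x ^+ 2 / 4 * ((1 - x) * (5 - 2 * x)) by field.
  rewrite lerDl mulr_ge0 ?divr_ge0 ?sqr_ge0 // mulr_ge0; lra.
by have := le_trans e2 e1; rewrite ler_pM2r ?exprn_gt0.
Qed.

Section mean.
Variables (d : measure_display) (T : measurableType d) (R : realType).
Variable nu : probability T R.
Implicit Types f g : T -> R.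

Definition unit_valued f := measurable_fun setT f /\ forall t, 0 <= f t <= 1.

Definition mean f : R := fine (\int[nu]_t (f t)%:E)%E.

Lemma integral_cst_prob (c : \bar R) : (\int[nu]_t c = c)%E.
Proof.
rewrite (integral_cst nu measurableT) -[RHS]mule1; congr (_ * _)%E.
exact: probability_setT.
Qed.

Lemma unit_valued_integral f : unit_valued f -> (\int[nu]_t (f t)%:E)%E = (mean f)%:E.
Proof.
move=> [mf f01]; rewrite /mean fineK //; apply/fin_real.
have f0 t : (0 <= (f t)%:E)%E by rewrite lee_fin; case/andP: (f01 t).
apply/andP; split; first by rewrite (lt_le_trans (ltNyr 0)) // integral_ge0.
apply: (@le_lt_trans _ _ 1%E); last by rewrite ltry.
rewrite -(integral_cst_prob 1); apply: ge0_le_integral => //.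
- exact/measurable_EFinP.
- by move=> t _; rewrite lee_fin; case/andP: (f01 t).
Qed.

Lemma unit_valued_cst (a : R) : 0 <= a <= 1 -> unit_valued (cst a : T -> R).
Proof. by split=> // t; exact: measurable_cst. Qed.

Lemma mean_cst (a : R) : mean (cst a) = a.
Proof. exact: (congr1 fine (integral_cst_prob a%:E)). Qed.

Lemma mean_ge0 f : unit_valued f -> 0 <= mean f.
Proof.
move=> [mf f01]; rewrite /mean fine_ge0 // integral_ge0 // => t _.
by rewrite lee_fin; case/andP: (f01 t).
Qed.

Lemma mean_le1 f : unit_valued f -> mean f <= 1.
Proof.
move=> uf; rewrite -lee_fin -unit_valued_integral // -(integral_cst_prob 1).
have [mf f01] := uf; apply: ge0_le_integral => //.
- by move=> t _; rewrite lee_fin; case/andP: (f01 t).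
- exact/measurable_EFinP.
- by move=> t _; rewrite lee_fin; case/andP: (f01 t).
Qed.

Lemma integral_affine f a b : unit_valued f -> 0 <= a -> 0 <= b ->
  (\int[nu]_t (b + a * f t)%:E)%E = (b + a * mean f)%:E.
Proof.
move=> uf a0 b0; have [mf f01] := uf.
have f0 t : (0 <= (f t)%:E)%E by rewrite lee_fin; case/andP: (f01 t).
under eq_integral do rewrite EFinD EFinM.
rewrite ge0_integralD //; first last.
- by apply: measurable_funeM; exact/measurable_EFinP.
- by move=> t _; rewrite mule_ge0.
rewrite integral_cst_prob ge0_integralZl //; last exact/measurable_EFinP.
by rewrite unit_valued_integral.
Qed.

End mean.

(** * Haar probability measures on the stabilizers *)

Section haar_on_stabilizers.
Variables (R : realType) (n : nat).
Local Notation MT := (borel_mx R n).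
Local Notation mulM := (fun (S T : MT) => (S : 'M[R]_n) *m (T : 'M[R]_n) : MT).
Local Notation trM := (fun S : MT => ((S : 'M[R]_n)^T : MT)).

Lemma mx_measurable_id : mx_measurable (fun S : MT => (S : 'M[R]_n)).
Proof. exact: measurable_mx_coord. Qed.

Lemma measurable_mx_eq d (T : measurableType d) p q (f : T -> 'M[R]_(p, q))
    (M : 'M[R]_(p, q)) :
  mx_measurable f -> measurable [set t | f t = M].
Proof.
move=> mf.
have -> : [set t | f t = M]
    = \bigcap_(i in setT) \bigcap_(j in setT) [set t | f t i j = M i j].
  apply/seteqP; split => [t /= ft i _ j _ /=|t h]; first by rewrite ft.
  by apply/matrixP => i j; exact: h.
apply: fin_bigcap_measurable => // i _; apply: fin_bigcap_measurable => // j _.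
rewrite -[X in measurable X]setTI; exact: (mf i j measurableT [set M i j]).
Qed.

Lemma measurable_stab m : measurable (stab m : set MT).
Proof.
have -> : (stab m : set MT) =
   ([set S : MT | (S : 'M[R]_n) *m (S : 'M[R]_n)^T = 1%:M]
   `&` [set S : MT | \det (S : 'M[R]_n) = 1])
   `&` \bigcap_(i in [set i : 'I_n | (i < m)%N])
      [set S : MT | row i (S : 'M[R]_n) = row i 1%:M].
  by apply/seteqP; split => S.
apply: measurableI; first apply: measurableI.
- apply: measurable_mx_eq.
  by apply: mx_measurable_mul; last apply: mx_measurable_tr; exact: mx_measurable_id.
- rewrite -[X in measurable X]setTI.
  exact: (measurable_det mx_measurable_id measurableT (measurable_set1 1)).
- apply: fin_bigcap_measurable => // i _; apply: measurable_mx_eq.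
  apply: mx_measurable_row; exact: mx_measurable_id.
Qed.

Lemma measurable_mulM d (T : measurableType d) (f g : T -> MT) :
  measurable_fun setT f -> measurable_fun setT g ->
  measurable_fun setT (fun t => mulM (f t) (g t)).
Proof.
move=> /measurable_to_borelP mf /measurable_to_borelP mg.
by apply/measurable_to_borelP; exact: mx_measurable_mul.
Qed.

Lemma measurable_trM d (T : measurableType d) (f : T -> MT) :
  measurable_fun setT f -> measurable_fun setT (fun t => trM (f t)).
Proof.
move=> /measurable_to_borelP mf; apply/measurable_to_borelP.
exact: mx_measurable_tr.
Qed.

(** Haar measure on the stabilizer, seen as a Borel measure on all matrices. The
mass condition says that it is carried by the stabilizer. *)
Definition haar_on (m : nat) (nu : probability MT R) : Prop :=
  nu (stab m) = 1%E /\
  forall U, stab m U -> forall B : set MT, measurable B ->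
    nu ((mulM U) @^-1` B) = nu B.

Section integrals.
Variables (m : nat) (nu : probability MT R).
Hypothesis nuH : haar_on m nu.
Local Open Scope ereal_scope.

Lemma haar_ae (Q : MT -> Prop) :
  (forall S, stab m S -> Q S) -> {ae nu, forall S, setT S -> Q S}.
Proof.
move=> HQ; exists (~` stab m); split.
- exact: measurableC (measurable_stab m).
- rewrite [LHS](probability_setC nu (measurable_stab m)).
  by rewrite nuH.1 subee.
- by move=> S /= nQ HS; apply: nQ => _; exact: HQ.
Qed.

Lemma haar_eq_integral (f g : MT -> \bar R) :
    measurable_fun setT f -> measurable_fun setT g ->
    (forall S, 0 <= f S) -> (forall S, 0 <= g S) ->
    (forall S, stab m S -> f S = g S) ->
  \int[nu]_S f S = \int[nu]_S g S.
Proof.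
move=> mf mg f0 g0 fg; apply: ge0_ae_eq_integral => //.
exact: haar_ae.
Qed.

Lemma haar_le_integral (f g : MT -> \bar R) :
    measurable_fun setT f -> measurable_fun setT g ->
    (forall S, 0 <= f S) -> (forall S, 0 <= g S) ->
    (forall S, stab m S -> f S <= g S) ->
  \int[nu]_S f S <= \int[nu]_S g S.
Proof.
move=> mf mg f0 g0 fg; apply: ae_ge0_le_integral => //.
exact: haar_ae.
Qed.

Lemma haar_left (U : 'M[R]_n) (h : MT -> \bar R) : stab m U ->
    measurable_fun setT h -> (forall S, 0 <= h S) ->
  \int[nu]_S h (mulM U S) = \int[nu]_S h S.
Proof.
move=> HU mh h0.
have mU : measurable_fun setT (mulM U).
  by apply: measurable_mulM => //; exact: measurable_id.
transitivity (\int[pushforward nu (mulM U)]_S h S).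
  by rewrite ge0_integral_pushforward.
by apply: eq_measure_integral => B mB _; exact: nuH.2.
Qed.

(** Integrate h(S^T T) over S and T. Left invariance in T gives the integral of h;
left invariance in S, after rewriting S^T T as (T^T S)^T, gives the integral of
h composed with the transpose. *)
Lemma haar_inv (h : MT -> \bar R) :
    measurable_fun setT h -> (forall S, 0 <= h S) ->
  \int[nu]_S h (trM S) = \int[nu]_S h S.
Proof.
move=> mh h0.
have m1 : measurable_fun setT (fun p : MT * MT => h (mulM (trM p.1) p.2)).
  apply: (measurableT_comp mh); apply: measurable_mulM => //.
  exact: measurable_trM.
have mtr : measurable_fun setT (h \o trM).
  by apply: (measurableT_comp mh); apply: measurable_trM; exact: measurable_id.
have cst_int (c : \bar R) : \int[nu]_S cst c S = c.
  by rewrite integral_cst // -[RHS]mule1; congr (_ * _); exact: probability_setT.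
transitivity (\int[nu]_T \int[nu]_S h (mulM (trM S) T)).
  rewrite -[LHS]cst_int; apply: haar_eq_integral => //.
  - exact: (measurable_fun_fubini_tonelli_G (fun p : MT * MT => h (mulM (trM p.1) p.2))).
  - by move=> S; apply: integral_ge0.
  - by move=> T; apply: integral_ge0.
  move=> T HT /=.
  rewrite -(haar_left (stab_tr HT) mtr (fun S => h0 _)) //.
  by apply: eq_integral => S _ /=; rewrite trmx_mul trmxK.
transitivity (\int[nu]_S \int[nu]_T h (mulM (trM S) T)).
  by apply/esym; apply: (fubini_tonelli (fun p : MT * MT => h (mulM (trM p.1) p.2))).
rewrite -[RHS]cst_int; apply: haar_eq_integral => //.
- exact: (measurable_fun_fubini_tonelli_F (fun p : MT * MT => h (mulM (trM p.1) p.2))).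
- by move=> S; apply: integral_ge0.
- by move=> T; apply: integral_ge0.
by move=> S HS /=; rewrite (haar_left (stab_tr HS) mh).
Qed.

Lemma haar_right (U : 'M[R]_n) (h : MT -> \bar R) : stab m U ->
    measurable_fun setT h -> (forall S, 0 <= h S) ->
  \int[nu]_S h (mulM S U) = \int[nu]_S h S.
Proof.
move=> HU mh h0.
have mtr : measurable_fun setT (h \o trM).
  by apply: (measurableT_comp mh); apply: measurable_trM; exact: measurable_id.
have mU : measurable_fun setT (fun S => h (mulM S U)).
  by apply: (measurableT_comp mh); apply: measurable_mulM => //; exact: measurable_id.
rewrite -(haar_inv mU) // -[RHS]haar_inv //.
rewrite -(haar_left (stab_tr HU) mtr (fun S => h0 _)) //.
by apply: eq_integral => S _ /=; rewrite trmx_mul trmxK.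
Qed.

End integrals.

End haar_on_stabilizers.

(** * One step of the chain of stabilizers *)

Section stabilizer_chain.
Variables (R : realType) (n : nat).
Local Notation MT := (borel_mx R n).
Local Notation SO := (special_orthogonal R n).
Implicit Types (nu : probability MT R) (f g : MT -> R).

Section one_measure.
Variables (m : nat) (nu : probability MT R).
Hypothesis nuH : haar_on m nu.

Lemma mean_haar_le f g c : unit_valued f -> unit_valued g -> 0 <= c ->
  (forall S, stab m S -> f S <= g S + c) -> mean nu f <= mean nu g + c.
Proof.
move=> uf ug c0 fg; have [mf f01] := uf; have [mg g01] := ug.
have := integral_affine nu ug ler01 c0; rewrite mul1r addrC => gE.
rewrite -lee_fin -gE -unit_valued_integral //; apply: (haar_le_integral nuH).
- exact/measurable_EFinP.
- apply/measurable_EFinP; apply: measurable_funD => //.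
  exact: measurable_funM.
- by move=> S; rewrite lee_fin; case/andP: (f01 S).
- by move=> S; rewrite lee_fin addr_ge0 // mulr_ge0 //; case/andP: (g01 S).
- by move=> S HS; rewrite lee_fin mul1r addrC fg.
Qed.

Section oscillation.
Variables (g : MT -> R) (c : R).
Hypotheses (ug : unit_valued g) (c0 : 0 <= c).
Hypothesis osc : forall S T, stab m S -> stab m T -> g S <= g T + c.

Lemma sub_mean_le_osc S : stab m S -> g S - mean nu g <= c.
Proof.
move=> HS; rewrite lerBlDl -[leLHS](mean_cst nu).
apply: mean_haar_le => //; first exact: unit_valued_cst (ug.2 S).
by move=> T HT; exact: osc.
Qed.

Lemma mean_sub_le_osc S : stab m S -> mean nu g - g S <= c.
Proof.
move=> HS; rewrite lerBlDl -[X in X + c](mean_cst nu).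
apply: mean_haar_le => //; first exact: unit_valued_cst (ug.2 S).
by move=> T HT; exact: osc.
Qed.

(** A weak form of Hoeffding's lemma. It bounds exp(lam (g - mean g)) by
1 + lam (g - mean g) + 2 (lam c)^2 and integrates; the linear term vanishes. *)
Lemma expR_mean_le (lam : R) : 0 <= lam -> lam * c <= 1 ->
  (\int[nu]_S (expR (lam * g S))%:E
     <= (expR (lam * mean nu g + 2 * (lam * c) ^+ 2))%:E)%E.
Proof.
move=> lam0 lamc; have [mg g01] := ug.
set mu := mean nu g; set K := 2 * (lam * c) ^+ 2; set A := expR (lam * mu).
have mu0 : 0 <= mu by exact: mean_ge0.
have A0 : 0 <= A by exact: expR_ge0.
have K0 : 0 <= K by rewrite mulr_ge0 ?sqr_ge0.
have mexp : measurable_fun setT (fun S => expR (lam * g S)).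
  by apply: measurableT_comp => //; exact: measurable_funM.
have B0 : 0 <= A * (lam * mu) by rewrite !mulr_ge0.
(* The multiple of lam * mu is added on both sides to keep the integrands
   nonnegative. *)
have lemain : (\int[nu]_S ((expR (lam * g S))%:E + (A * (lam * mu))%:E)
    <= (A * (1 + K) + A * lam * mu)%:E)%E.
  rewrite -(integral_affine nu ug) ?mulr_ge0 ?addr_ge0 //.
  apply: (haar_le_integral nuH).
  - by apply/emeasurable_funD => //; exact/measurable_EFinP.
  - apply/measurable_EFinP; apply: measurable_funD => //.
    exact: measurable_funM.
  - by move=> S; rewrite lee_fin addr_ge0 ?expR_ge0.
  - move=> S; rewrite lee_fin addr_ge0 ?mulr_ge0 ?addr_ge0 //.
    by case/andP: (g01 S).
  move=> S HS; rewrite -EFinD lee_fin.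
  have h1 := sub_mean_le_osc HS; have h2 := mean_sub_le_osc HS.
  have -> : expR (lam * g S) = A * expR (lam * (g S - mu)).
    by rewrite -expRD; congr expR; ring.
  have x1 : lam * (g S - mu) <= 1.
    by apply: le_trans lamc; rewrite ler_wpM2l.
  have le1 : expR (lam * (g S - mu)) <= 1 + lam * (g S - mu) + K.
    apply: le_trans (expR_le_quadratic x1) _; rewrite lerD2l ler_wpM2l //.
    rewrite !exprMn ler_wpM2l ?sqr_ge0 // -[leLHS]real_normK ?num_real //.
    rewrite ler_sqr ?nnegrE // ler_norml h1 andbT lerNl.
    by rewrite opprB.
  rewrite -lerBrDr; apply: le_trans (ler_wpM2l A0 le1) _.
  by rewrite le_eqVlt; apply/orP; left; apply/eqP; ring.
move: lemain; rewrite ge0_integralD //; last exact/measurable_EFinP.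
rewrite integral_cst_prob EFinD -(mulrA A lam mu) leeD2rE //.
move=> /le_trans; apply; rewrite lee_fin expRD -/A ler_wpM2l //.
exact: expR_ge1Dx.
Qed.

End oscillation.

End one_measure.

(** The measure is the law of phi(S) = S T, with T the turn of row i of S. Left
multiplication by U in the smaller stabilizer leaves row i unchanged, hence
phi(U S) = U phi(S), and left invariance is inherited. *)
Lemma haar_step (i l : 'I_n) nu : (i < l)%N -> haar_on i nu ->
  exists nu' : probability MT R, haar_on i.+1 nu'.
Proof.
move=> il nuH.
pose phi (S : MT) : MT := (S : 'M[R]_n) *m turn i l (row i (S : 'M[R]_n)).
have mphi : measurable_fun setT phi.
  apply/measurable_to_borelP.
  have mid := @mx_measurable_id R n.
  have mv : mx_measurable (fun S : MT => row i (S : 'M[R]_n) - row i 1%:M).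
    by apply: mx_measurable_sub; [exact: mx_measurable_row|exact: mx_measurable_cst].
  have mvv := mx_measurable_mul (mx_measurable_tr mv) mv.
  have mdot := mx_measurable_mul mv (mx_measurable_tr mv).
  have mH : mx_measurable (fun S : MT => householder (row i (S : 'M[R]_n) - row i 1%:M)).
    apply: mx_measurable_sub; first exact: mx_measurable_cst.
    apply: mx_measurable_scale => //; apply: measurable_funM => //.
    apply: measurable_inv_ge0; last exact: mdot.
    move=> S; rewrite mxE sumr_ge0 // => j _.
    by rewrite [X in _ * X]mxE -expr2 sqr_ge0.
  apply: mx_measurable_mul => //; apply: mx_measurable_mul => //.
  move=> a b; rewrite /det_fix.
  have mdet := measurable_det mH.
  under eq_fun do rewrite !mxE.
  have [ab|ab] := eqVneq a b; last first.
    by under eq_fun do rewrite mulr0n; exact: measurable_cst.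
  under eq_fun do rewrite mulr1n; case: (a == l); first exact: mdet.
  exact: measurable_cst.
pose aphi := isMeasurableFun.Build _ _ MT MT phi mphi.
pose Phi : {mfun MT >-> MT} := HB.pack phi aphi.
exists (distribution nu Phi); split.
  apply/eqP; rewrite eq_le probability_le1 /=; last exact: measurable_stab.
  rewrite -nuH.1; apply: le_measure; rewrite ?inE.
  - exact: measurable_stab.
  - rewrite -[X in measurable X]setTI.
    exact: (mphi measurableT _ (measurable_stab _)).
  - by move=> S /(stab_turn il).
move=> U HU B mB; rewrite /distribution /pushforward /=.
have mBphi : measurable (phi @^-1` B).
  by rewrite -[X in measurable X]setTI; exact: (mphi measurableT _ mB).
transitivity (nu ((fun S : MT => U *m (S : 'M[R]_n) : MT) @^-1` (phi @^-1` B))).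
  congr (nu _); rewrite -comp_preimage; congr (_ @^-1` B).
  apply/funext => S /=; rewrite /phi row_mul HU.2 //.
  by rewrite -row_mul mul1mx mulmxA.
exact: (nuH.2 U (stab_anti (leqnSn _) HU) _ mBphi).
Qed.

End stabilizer_chain.

(** * Concentration under Haar measure *)

Section concentration.
Variables (R : realType) (n : nat).
Local Notation MT := (borel_mx R n).
Local Notation SO := (special_orthogonal R n).
Implicit Types (nu : probability MT R) (f g : MT -> R).

(** The inequality is one-sided because T can be undone by its transpose, which
has the same rank defect. *)
Definition lipschitz_turns (c : R) f := forall S T V : 'M[R]_n,
  SO S -> SO T -> SO V -> (\rank (T - 1%:M)%R <= 2)%N ->
  f (S *m T *m V) <= f (S *m V) + c.

Lemma unit_valued_mulr f (V : 'M[R]_n) : unit_valued f ->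
  unit_valued (fun S : MT => f ((S : 'M[R]_n) *m V)).
Proof.
move=> [mf f01]; split => [|S]; last exact: f01.
apply: (measurableT_comp mf); apply: measurable_mulM => //; exact: measurable_id.
Qed.

(** Induction along the chain of stabilizers. With nu' Haar on the stabilizer of
one more coordinate, g(V), the mean over S of f(S V) under nu', has the same mean
as f, and the induction hypothesis applied to S |-> f(S V) bounds the exponential
moment of f by that of g. For V = Q V' with Q = U T^T in the larger stabilizer, U
is absorbed by right invariance of nu' and T^T costs c, so g oscillates by at most
c and expR_mean_le applies. The smaller stabilizer is reached through a turn with
a correcting coordinate beyond m, which is why m + p < n is assumed as soon as
there is a step to take. *)
Lemma haar_mgf_le (p m : nat) nu f (c lam : R) : (0 < p -> m + p < n)%N ->
    haar_on m nu -> unit_valued f -> 0 <= c -> 0 <= lam -> lam * c <= 1 ->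
    (forall U S, stab (m + p) U -> SO S -> f (U *m S) = f S) ->
    lipschitz_turns c f ->
  (\int[nu]_S (expR (lam * f S))%:E
     <= (expR (lam * mean nu f + p%:R * (2 * (lam * c) ^+ 2)))%:E)%E.
Proof.
elim: p m nu f => [|p IHp] m nu f mpn nuH uf c0 lam0 lamc finv flip.
  have [mf f01] := uf; rewrite addn0 in finv.
  have f1 S : stab m S -> f S = f (1%:M : 'M[R]_n).
    by move=> HS; rewrite -(finv S 1%:M) ?mulmx1 //; exact: SO_one.
  rewrite mul0r addr0.
  have -> : mean nu f = f (1%:M : 'M[R]_n).
    rewrite /mean -[RHS]/(fine (f (1%:M : 'M[R]_n))%:E); congr fine.
    rewrite -[RHS](integral_cst_prob nu).
    apply: (haar_eq_integral nuH).
    - exact/measurable_EFinP.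
    - exact: measurable_cst.
    - by move=> S; rewrite lee_fin; case/andP: (f01 S).
    - by move=> S; rewrite lee_fin; case/andP: (f01 (1%:M : 'M[R]_n)).
    - by move=> S /f1 ->.
  rewrite -(integral_cst_prob nu (expR _)%:E).
  apply: (haar_le_integral nuH).
  - apply/measurable_EFinP; apply: measurableT_comp => //.
    exact: measurable_funM.
  - exact: measurable_cst.
  - by move=> S; rewrite lee_fin expR_ge0.
  - by move=> S; rewrite lee_fin expR_ge0.
  - by move=> S /f1 ->.
have [mf f01] := uf.
have mpn' : (m + p.+1 < n)%N by exact: mpn.
have mn : (m < n)%N by apply: leq_ltn_trans mpn'; exact: leq_addr.
have ln : (n.-1 < n)%N by rewrite prednK //; exact: leq_ltn_trans mn.
pose i := Ordinal mn; pose l := Ordinal ln.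
have il : (i < l)%N.
  rewrite /= -subn1 ltn_subRL add1n; apply: leq_ltn_trans mpn'.
  by rewrite addnS ltnS leq_addr.
have [nu' nu'H] : exists nu' : probability MT R, haar_on m.+1 nu'.
  exact: (@haar_step _ _ i l nu il nuH).
pose K := 2 * (lam * c) ^+ 2.
pose g (V : MT) : R := mean nu' (fun S : MT => f ((S : 'M[R]_n) *m (V : 'M[R]_n))).
have mul2 : measurable_fun setT
    (fun q : MT * MT => (q.1 : 'M[R]_n) *m (q.2 : 'M[R]_n) : MT).
  exact: measurable_mulM.
have ufV (V : 'M[R]_n) := unit_valued_mulr V uf.
have average (h : MT -> \bar R) : measurable_fun setT h -> (forall S, 0 <= h S)%E ->
    (\int[nu]_V \int[nu']_S h ((S : 'M[R]_n) *m (V : 'M[R]_n)) = \int[nu]_S h S)%E.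
  move=> mh h0; pose hh (q : MT * MT) : \bar R := h ((q.1 : 'M[R]_n) *m (q.2 : 'M[R]_n)).
  have mhh : measurable_fun setT hh by exact: (measurableT_comp mh mul2).
  transitivity (\int[nu']_S \int[nu]_V hh (S, V))%E.
    exact/esym/(fubini_tonelli hh mhh (fun q => h0 _)).
  rewrite -[RHS](integral_cst_prob nu'); apply: (haar_eq_integral nu'H).
  - exact: (measurable_fun_fubini_tonelli_F hh mhh (fun q => h0 _)).
  - exact: measurable_cst.
  - by move=> S; apply: integral_ge0 => V _; exact: h0.
  - by move=> S; apply: integral_ge0.
  by move=> S /(stab_anti (leqnSn _)) HS; rewrite /hh /= (haar_left nuH HS mh).
have mg : measurable_fun setT g.
  apply: measurableT_comp => //.
  apply: (@measurable_fun_fubini_tonelli_G _ _ _ _ _ nu'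
    (fun q : MT * MT => (f ((q.1 : 'M[R]_n) *m (q.2 : 'M[R]_n)))%:E)).
    by apply/measurable_EFinP; exact: (measurableT_comp mf mul2).
  by move=> q; rewrite lee_fin; case/andP: (f01 ((q.1 : 'M[R]_n) *m (q.2 : 'M[R]_n))).
have ug : unit_valued g.
  split=> // V; apply/andP; split; [exact: mean_ge0|exact: mean_le1].
have mean_g : mean nu g = mean nu f.
  rewrite /mean; congr fine; rewrite -[RHS]average.
  - by apply: eq_integral => V _; rewrite -unit_valued_integral.
  - exact/measurable_EFinP.
  - by move=> S; rewrite lee_fin; case/andP: (f01 S).
have mexp : measurable_fun setT (fun S => (expR (lam * f S))%:E).
  apply/measurable_EFinP; apply: measurableT_comp => //.
  exact: measurable_funM.
have exp0 S : (0 <= (expR (lam * f S))%:E)%E by rewrite lee_fin expR_ge0.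
rewrite -(average _ mexp exp0).
have inner V : SO V -> (\int[nu']_S (expR (lam * f ((S : 'M[R]_n) *m V)))%:E
    <= (expR (p%:R * K))%:E * (expR (lam * g V))%:E)%E.
  move=> SOV; rewrite -EFinM -expRD addrC; apply: (IHp m.+1 nu') => //.
  - by move=> _; rewrite addSnnS.
  - move=> U S HU SOS; rewrite -mulmxA finv //; last exact: SO_mul.
    by rewrite -addSnnS.
  - move=> S T V' SOS SOT SOV' rT.
    have := flip S T (V' *m V); rewrite !mulmxA; apply => //; exact: SO_mul.
have mexpg : measurable_fun setT (fun S => (expR (lam * g S))%:E).
  apply/measurable_EFinP; apply: measurableT_comp => //.
  exact: measurable_funM.
apply: (@le_trans _ _ (\int[nu]_V ((expR (p%:R * K))%:E * (expR (lam * g V))%:E))%E).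
  apply: (haar_le_integral nuH).
  - apply: (@measurable_fun_fubini_tonelli_G _ _ _ _ _ nu'
      (fun q : MT * MT => (expR (lam * f ((q.1 : 'M[R]_n) *m (q.2 : 'M[R]_n))))%:E)).
      exact: (measurableT_comp mexp mul2).
    by move=> q; rewrite lee_fin expR_ge0.
  - exact: measurable_funeM.
  - by move=> V; apply: integral_ge0 => S _; rewrite lee_fin expR_ge0.
  - by move=> V; rewrite -EFinM lee_fin mulr_ge0 ?expR_ge0.
  - by move=> V /stab_SO /inner.
rewrite ge0_integralZl //.
have osc V V' : stab m V -> stab m V' -> g V <= g V' + c.
  move=> HV HV'; pose Q : 'M[R]_n := V *m V'^T.
  have HQ : stab m Q by apply: stab_mul => //; exact: stab_tr.
  pose T := turn i l (row i Q).
  have HU : stab m.+1 (Q *m T) by exact: (stab_turn il HQ).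
  have SOT : SO T by exact: SO_turn.
  have VE : V = Q *m T *m T^T *m V'.
    rewrite -(mulmxA Q) SOT.1 mulmx1 -mulmxA.
    by rewrite (mulmx1C (stab_SO HV').1) mulmx1.
  have gV : g V = mean nu' (fun S : MT => f ((S : 'M[R]_n) *m (T^T *m V'))).
    rewrite /g /mean; congr fine.
    rewrite -(haar_right nu'H HU (h := fun S => (f ((S : 'M[R]_n) *m (T^T *m V')))%:E)).
    - by apply: eq_integral => S _; rewrite {1}VE /= !mulmxA.
    - by apply/measurable_EFinP; exact: (ufV (T^T *m V')).1.
    - by move=> S; rewrite lee_fin; case/andP: (f01 ((S : 'M[R]_n) *m (T^T *m V'))).
  rewrite gV; apply: (mean_haar_le nu'H) => //.
  move=> S /stab_SO SOS; rewrite mulmxA; apply: flip => //.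
  - exact: SO_tr.
  - exact: stab_SO HV'.
  rewrite -mxrank_tr linearB /= trmxK trmx1; exact: mxrank_turn.
have := expR_mean_le nuH ug c0 osc lam0 lamc; rewrite mean_g => le_g.
apply: le_trans (lee_wpmul2l _ le_g) _; first by rewrite lee_fin expR_ge0.
rewrite -EFinM -expRD lee_fin ler_expR le_eqVlt; apply/orP; left; apply/eqP.
by rewrite -/K -[in RHS]natr1; ring.
Qed.

End concentration.

Section tails.
Variables (R : realType) (n : nat).
Local Notation MT := (borel_mx R n).
Local Notation SO := (special_orthogonal R n).
Implicit Types (nu : probability MT R) (f g : MT -> R).

(** What concentration needs to know about f, in a form that is stable under
f |-> 1 - f; upper and lower tails are then exchanged. *)
Definition admissible (p : nat) (c : R) f := [/\ unit_valued f,
  forall U S : 'M[R]_n, stab p U -> SO S -> f (U *m S) = f S &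
  lipschitz_turns c f].

Lemma unit_valued_compl d (T : measurableType d) (f : T -> R) :
  unit_valued f -> unit_valued (fun t => 1 - f t).
Proof.
move=> [mf f01]; split => [|t]; first exact: measurable_funB.
by have /andP[] := f01 t; lra.
Qed.

Lemma mean_compl d (T : measurableType d) (nu : probability T R) (f : T -> R) :
  unit_valued f -> mean nu (fun t => 1 - f t) = 1 - mean nu f.
Proof.
move=> uf; have uf' := unit_valued_compl uf.
apply/eqP; rewrite -subr_eq opprK; apply/eqP.
suff : ((mean nu (fun t => 1 - f t))%:E + (mean nu f)%:E = 1)%E by move=> [].
rewrite -!unit_valued_integral // -ge0_integralD //.
- rewrite -[RHS](integral_cst_prob nu); apply: eq_integral => t _.
  by rewrite -EFinD subrK.
- by move=> t _; rewrite lee_fin; case/andP: (uf'.2 t).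
- by apply/measurable_EFinP; case: uf'.
- by move=> t _; rewrite lee_fin; case/andP: (uf.2 t).
- by apply/measurable_EFinP; case: uf.
Qed.

Lemma admissible_compl p c f : admissible p c f -> admissible p c (fun S => 1 - f S).
Proof.
move=> [uf finv flip]; split => [|U S HU SOS|S T V SOS SOT SOV rT].
- exact: unit_valued_compl.
- by rewrite finv.
suff : f (S *m V) <= f (S *m T *m V) + c by lra.
have {1}-> : f (S *m V) = f (S *m T *m T^T *m V).
  by congr (f (_ *m V)); rewrite -mulmxA SOT.1 mulmx1.
apply: flip => //; [exact: SO_mul|exact: SO_tr|].
by rewrite -mxrank_tr linearB /= trmxK trmx1.
Qed.

Lemma upper_tail p nu f (c lam r : R) : (0 < p -> p < n)%N ->
    haar_on 0 nu -> admissible p c f -> 0 <= c -> 0 < lam -> lam * c <= 1 ->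
  (nu [set S | (mean nu f + r <= f S)%R]
    <= (expR (p%:R * (2 * (lam * c) ^+ 2) - lam * r))%:E)%E.
Proof.
move=> pn nuH [uf finv flip] c0 lam0 lamc.
have mf := uf.1.
pose af := isMeasurableFun.Build _ _ MT R f mf.
pose Y : {RV nu >-> R} := HB.pack f af.
have := chernoff Y (mean nu f + r) lam0.
move=> /le_trans; apply; rewrite /mmt_gen_fun unlock.
have mgf := @haar_mgf_le _ _ p 0 nu f c lam pn nuH uf c0 (ltW lam0) lamc finv flip.
have -> : (\int[nu]_S (expR (f S * lam))%:E = \int[nu]_S (expR (lam * f S))%:E)%E.
  by apply: eq_integral => S _; rewrite mulrC.
apply: le_trans (lee_wpmul2r _ mgf) _; first by rewrite lee_fin expR_ge0.
rewrite -EFinM lee_fin -expRD ler_expR le_eqVlt; apply/orP; left; apply/eqP; ring.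
Qed.

Lemma lower_tail p nu f (c lam r : R) : (0 < p -> p < n)%N ->
    haar_on 0 nu -> admissible p c f -> 0 <= c -> 0 < lam -> lam * c <= 1 ->
  (nu [set S | (f S <= mean nu f - r)%R]
    <= (expR (p%:R * (2 * (lam * c) ^+ 2) - lam * r))%:E)%E.
Proof.
move=> pn nuH af c0 lam0 lamc.
have := upper_tail r pn nuH (admissible_compl af) c0 lam0 lamc.
rewrite mean_compl; last by case: af.
congr (nu _ <= _)%E; apply: eq_set => S; apply/propext.
by split; lra.
Qed.

End tails.

(** * Tails of the spectral distribution at a point *)

Section spectral_functions.
Local Open Scope complex_scope.
Variables (R : realType) (k n : nat) (k_gt0 : (0 < k)%N) (kn : (k <= n)%N).
Variables (G : 'M[R[i]]_n).
Hypothesis G_herm : G \is hermsymmx.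
Local Notation MT := (borel_mx R n).
Local Notation SO := (special_orthogonal R n).

Definition block_cdf (x : R) (M : MT) : R :=
  spectral_cdf (rotated_block kn G M) x.

Definition block_cdf_left (x : R) (M : MT) : R :=
  (count (fun z => z < x%:C) (eigenvalues (rotated_block kn G M)))%:R / k%:R.

Let k0 : 0 < k%:R :> R. Proof. by rewrite ltr0n. Qed.

Lemma ratio_bounds (a : nat) : (a <= k)%N -> 0 <= (a%:R / k%:R : R) <= 1.
Proof. by move=> ak; rewrite divr_ge0 //= ler_pdivrMr // mul1r ler_nat. Qed.

Lemma block_cdf_bounds x M : 0 <= block_cdf x M <= 1.
Proof. by apply: ratio_bounds; rewrite (leq_trans (count_size _ _)) // size_eigenvalues. Qed.

Lemma block_cdf_left_bounds x M : 0 <= block_cdf_left x M <= 1.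
Proof. by apply: ratio_bounds; rewrite (leq_trans (count_size _ _)) // size_eigenvalues. Qed.

Lemma block_cdf_mono x y M : x <= y -> block_cdf x M <= block_cdf y M.
Proof.
move=> xy; rewrite ler_wpM2r ?invr_ge0 // ler_nat; apply: sub_count => z /= zx.
by apply: le_trans zx _; rewrite lecR.
Qed.

Lemma block_cdf_lt_left x y M : x < y -> block_cdf x M <= block_cdf_left y M.
Proof.
move=> xy; rewrite ler_wpM2r ?invr_ge0 // ler_nat; apply: sub_count => z /= zx.
by apply: le_lt_trans zx _; rewrite ltcR.
Qed.

Lemma near_block_cdf_right x M :
  \forall m \near \oo, block_cdf (x + m.+1%:R^-1) M = block_cdf x M.
Proof.
apply: filterS (near_count_right (eigenvalues (rotated_block kn G M)) x) => m.
by rewrite /block_cdf /spectral_cdf => ->.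
Qed.

Lemma near_block_cdf_left x M :
  \forall m \near \oo, block_cdf (x - m.+1%:R^-1) M = block_cdf_left x M.
Proof.
apply: filterS (near_count_left (eigenvalues (rotated_block kn G M)) x) => m.
by rewrite /block_cdf /spectral_cdf /block_cdf_left => ->.
Qed.

Lemma near_block_cdf_pinfty M : \forall m \near \oo, block_cdf m%:R M = 1.
Proof.
have er : {in eigenvalues (rotated_block kn G M), forall z, z \is Num.real}.
  by move=> z; apply: eigenvalues_real; exact: rotated_block_herm.
apply: filterS (near_count_pinfty er) => m.
by rewrite /block_cdf /spectral_cdf => ->; rewrite size_eigenvalues divff ?gt_eqF.
Qed.

Lemma near_block_cdf_ninfty M : \forall m \near \oo, block_cdf (- m%:R) M = 0.
Proof.
apply: filterS (near_count_ninfty (eigenvalues (rotated_block kn G M))) => m.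
by rewrite /block_cdf /spectral_cdf => ->; rewrite mul0r.
Qed.

Lemma block_cdf_unit_valued x : unit_valued (block_cdf x).
Proof.
split; last exact: block_cdf_bounds.
apply: measurable_funM; last exact: measurable_cst.
exact: measurable_eigcount.
Qed.

Lemma block_cdf_left_unit_valued x : unit_valued (block_cdf_left x).
Proof.
split; last exact: block_cdf_left_bounds.
apply: (@measurable_fun_cvg _ _ _ _ (fun m => block_cdf (x - m.+1%:R^-1))) => //.
  by move=> m; exact: (block_cdf_unit_valued _).1.
by move=> M _; apply: cvg_near_cst; exact: near_block_cdf_left.
Qed.

(** For k = n the last step of a chain of length k is not available, but the block
is then a conjugate of G and its spectrum is constant. *)
Definition chain_length := if (k < n)%N then k else 0%N.

(** For k < n the first k rows of U S are those of S; for k = n the two blocks are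
similar. *)
Lemma eigenvalues_rotated_block U S : stab chain_length U ->
  eigenvalues (rotated_block kn G (U *m S)) = eigenvalues (rotated_block kn G S).
Proof.
rewrite /chain_length; case: ltnP => [ltkn|nk] HU.
  rewrite !rotated_blockE.
  suff -> : top_rows kn (U *m S) = top_rows kn S by [].
  apply/row_matrixP => i; apply/rowP => j; rewrite !mxE.
  have /rowP/(_ j) : row (widen_ord kn i) (U *m S) = row (widen_ord kn i) S.
    by rewrite row_mul HU.2 //= -row_mul mul1mx.
  by rewrite !mxE => ->.
have nkE : n = k by apply/eqP; rewrite eqn_leq kn nk.
have UU := (stab_SO HU).1.
suff E : char_poly (rotated_block kn G (U *m S)) = char_poly (rotated_block kn G S).
  by rewrite /eigenvalues E.
clear nk; subst n.
have blockE M : rotated_block kn G M = conjugated_mx G M.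
  apply/matrixP => i j; rewrite mxE; congr (conjugated_mx _ _ _ _); exact: val_inj.
rewrite !blockE /conjugated_mx; set Uc := map_mx (real_complex R) U.
have UUc : Uc *m Uc^T = 1%:M by rewrite /Uc map_trmx -map_mxM UU map_mx1.
have Uu : Uc^T \in unitmx by have [] := mulmx1_unit UUc.
have UcE : Uc = invmx Uc^T.
  by rewrite -[LHS]mulmx1 -(mulmxV Uu) mulmxA UUc mul1mx.
rewrite map_mxM trmx_mul -/Uc -[RHS](char_poly_similar _ Uu) -UcE.
by rewrite !mulmxA.
Qed.

Lemma block_cdf_admissible x : admissible chain_length (4 / k%:R) (block_cdf x).
Proof.
split; first exact: block_cdf_unit_valued.
  by move=> U S HU _; rewrite /block_cdf /spectral_cdf eigenvalues_rotated_block.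
move=> S T V _ _ _ rT; rewrite /block_cdf /spectral_cdf -mulrDl ler_wpM2r ?invr_ge0 //.
rewrite -natrD ler_nat.
have Hh := rotated_block_herm kn G_herm.
apply: leq_trans (eigcount_le_rank x (Hh _) (Hh (S *m V))) _.
rewrite leq_add2l (leq_trans (mxrank_rotated_block _ _ _ _)) // (leq_double _ 2).
rewrite -mxrank_opp opprB.
have -> : S *m T *m V - S *m V = S *m (T - 1%:M) *m V.
  by rewrite mulmxBr mulmx1 mulmxBl.
by rewrite (leq_trans (mxrankM_maxl _ _)) // (leq_trans (mxrankM_maxr _ _)).
Qed.

(** At any two given matrices, the left limits at x are the values of one and the
same block_cdf y, with y < x close to x. *)
Lemma block_cdf_left_admissible x : admissible chain_length (4 / k%:R) (block_cdf_left x).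
Proof.
split; first exact: block_cdf_left_unit_valued.
  by move=> U S HU _; rewrite /block_cdf_left eigenvalues_rotated_block.
move=> S T V SOS SOT SOV rT.
have [m [<- <-]] := filter_ex (filterI (near_block_cdf_left x (S *m T *m V))
  (near_block_cdf_left x (S *m V))).
by have [_ _] := block_cdf_admissible (x - m.+1%:R^-1); apply.
Qed.

(** With lam^2 = k/32 and c = 4/k one has (lam c)^2 = 1/(2k), so k steps cost
exp(1), and exp(1) <= 4. *)
Lemma block_tails (nu : probability MT R) (r : R) f (lam := Num.sqrt (k%:R / 32)) :
    haar_on 0 nu -> admissible chain_length (4 / k%:R) f ->
  (nu [set S | (mean nu f + r <= f S)%R] <= (4 * expR (- (r * lam)))%:E)%E /\
  (nu [set S | (f S <= mean nu f - r)%R] <= (4 * expR (- (r * lam)))%:E)%E.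
Proof.
move=> nuH af.
have lam0 : 0 < lam by rewrite sqrtr_gt0 divr_gt0.
have lam2 : lam ^+ 2 = k%:R / 32 by rewrite sqr_sqrtr // divr_ge0.
have c0 : 0 <= 4 / k%:R :> R by rewrite divr_ge0.
have lamc2 : (lam * (4 / k%:R)) ^+ 2 = (2 * k%:R)^-1.
  by rewrite exprMn lam2; field; rewrite gt_eqF.
have k1 : 1 <= k%:R :> R by rewrite ler1n.
have lamc : lam * (4 / k%:R) <= 1.
  rewrite -(ler_sqr (x := _ * _)) ?nnegrE ?mulr_ge0 ?(ltW lam0) //.
  by rewrite expr1n lamc2 invf_le1 //; lra.
have pn : (0 < chain_length -> chain_length < n)%N.
  by rewrite /chain_length; case: (ltnP k n).
have pk : (chain_length <= k)%N by rewrite /chain_length; case: (ltnP k n).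
have bound : expR (chain_length%:R * (2 * (lam * (4 / k%:R)) ^+ 2) - lam * r)
    <= 4 * expR (- (r * lam)).
  rewrite expRD mulrC [lam * r]mulrC mulrC ler_wpM2r ?expR_ge0 //.
  have := @expR_le_quadratic R 1 (lexx _).
  rewrite (_ : 1 + 1 + 2 * 1 ^+ 2 = 4 :> R); last by lra.
  apply: le_trans; rewrite ler_expR lamc2.
  rewrite (_ : 2 * (2 * k%:R)^-1 = k%:R^-1); last by field; rewrite gt_eqF.
  by rewrite ler_pdivrMr // mul1r ler_nat.
split.
  by apply: le_trans (upper_tail r pn nuH af c0 lam0 lamc) _; rewrite lee_fin.
by apply: le_trans (lower_tail r pn nuH af c0 lam0 lamc) _; rewrite lee_fin.
Qed.

End spectral_functions.

(** * Quantile grids *)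

Lemma mean_cvg d (T : measurableType d) (R : realType) (nu : probability T R)
    (h : nat -> T -> R) (f : T -> R) :
    (forall m, unit_valued (h m)) -> unit_valued f ->
    (forall t, \forall m \near \oo, h m t = f t) ->
  mean nu (h m) @[m --> \oo] --> mean nu f.
Proof.
move=> uh uf hf.
have [] := @dominated_convergence _ T R nu setT measurableT
  (fun m t => (h m t)%:E) (fun t => (f t)%:E) (cst 1%E).
- by move=> m; apply/measurable_EFinP; case: (uh m).
- by apply/measurable_EFinP; case: uf.
- by apply: aeW => t _; apply: cvg_near_cst; apply: filterS (hf t) => m ->.
- apply/integrableP; split => //; under eq_integral do rewrite /= normr1.
  by rewrite integral_cst_prob ltry.
- apply: aeW => t m _ /=; rewrite lee_fin ger0_norm; case/andP: ((uh m).2 t) => //.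
move=> _ _; rewrite unit_valued_integral // => cv.
apply: fine_cvg; apply: cvg_trans cv; apply: near_eq_cvg.
by apply: nearW => m.
Qed.

(** F is a distribution function, Fl its left limit; h is another distribution
function and hl bounds it from the left of each point. *)
Section quantile_grid.
Variables (R : realType) (F Fl : R -> R).
Hypotheses (F_mono : {homo F : x y / x <= y})
  (F_right : forall x, F (x + m.+1%:R^-1) @[m --> \oo] --> F x)
  (F_left : forall x, F (x - m.+1%:R^-1) @[m --> \oo] --> Fl x)
  (F_pinfty : F m%:R @[m --> \oo] --> (1 : R))
  (F_ninfty : F (- m%:R) @[m --> \oo] --> (0 : R))
  (F_unit : forall x, 0 <= F x <= 1).

Definition quantile (a : R) : R := inf [set x | a <= F x].

Section one_level.
Variable a : R.
Hypothesis a01 : 0 < a < 1.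

Lemma quantile_has_inf : has_inf [set x | a <= F x].
Proof.
have /andP[a0 a1] := a01; split.
  have /cvgr_ge/(_ a a1)/filter_ex[m am] := F_pinfty.
  by exists m%:R.
have /cvgr_lt/(_ a a0)/filter_ex[m am] := F_ninfty.
exists (- m%:R) => x /= ax; rewrite leNgt; apply/negP => /ltW /F_mono.
by rewrite leNgt (lt_le_trans am ax).
Qed.

Lemma quantile_le x : a <= F x -> quantile a <= x.
Proof. by move=> ax; apply: ge_inf => //; case: quantile_has_inf. Qed.

Lemma le_F_quantile : a <= F (quantile a).
Proof.
apply: (cvgr_to_ge (@F_right (quantile a))); apply: nearW => m.
have m0 : 0 < m.+1%:R^-1 :> R by rewrite invr_gt0.
have [y ay /ltW /F_mono] := inf_adherent m0 quantile_has_inf.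
exact: le_trans.
Qed.

Lemma F_left_quantile_le : Fl (quantile a) <= a.
Proof.
apply: (cvgr_to_le (@F_left (quantile a))); apply: nearW => m.
rewrite leNgt; apply/negP => /ltW /quantile_le.
by rewrite leNgt ltrBlDr ltrDl invr_gt0 ltr0n.
Qed.

End one_level.

Variables (h hl : R -> R) (l : nat) (D : R).
Hypotheses (h_mono : {homo h : x y / x <= y}) (h_unit : forall x, 0 <= h x <= 1)
  (h_left : forall x y, x < y -> h x <= hl y) (l_gt0 : (0 < l)%N) (D0 : 0 <= D).

(** Let F(x) lie between the levels j/l and (j+1)/l. To the left of x, the quantile
of level j/l bounds h(x) from below; to the right, the quantile of level (j+1)/l
bounds it from above, but x stays strictly below that quantile, so only left
limits there are under control. *)
Lemma quantile_grid :
    (forall j, (0 < j < l)%N ->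
       F (quantile (j%:R / l%:R)) - h (quantile (j%:R / l%:R)) <= D) ->
    (forall j, (0 < j < l)%N ->
       hl (quantile (j%:R / l%:R)) - Fl (quantile (j%:R / l%:R)) <= D) ->
  forall x, `|h x - F x| <= l%:R^-1 + D.
Proof.
move=> lo up x.
have l0 : 0 < l%:R :> R by rewrite ltr0n.
have level j : (0 < j < l)%N -> 0 < (j%:R / l%:R : R) < 1.
  move=> /andP[j0 jl]; rewrite divr_gt0 ?ltr0n //= ltr_pdivrMr // mul1r.
  by rewrite ltr_nat.
have /andP[F0 F1] := F_unit x; have /andP[h0 h1] := h_unit x.
(* The minimum puts F(x) = 1 into the last interval instead of an extra one. *)
pose t := Num.truncn (F x * l%:R); pose j := minn t l.-1.
have /andP[tle tlt] : t%:R <= F x * l%:R < t.+1%:R.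
  by apply: truncn_itv; rewrite mulr_ge0 // ltW.
have jl : (j < l)%N by rewrite -(prednK l_gt0) ltnS geq_minr.
have jF : j%:R / l%:R <= F x.
  by rewrite ler_pdivrMr // (le_trans _ tle) // ler_nat geq_minl.
have Fj_lt : (j.+1 < l)%N -> F x < j.+1%:R / l%:R.
  move=> jl'; rewrite ltr_pdivlMr // (lt_le_trans tlt) // ler_nat ltnS.
  by move: jl'; rewrite /j; lia.
have jS : j.+1%:R / l%:R = j%:R / l%:R + l%:R^-1 :> R.
  by rewrite -natr1 mulrDl mul1r.
have last_level : (l <= j.+1)%N -> 1 <= j.+1%:R / l%:R :> R.
  by move=> lj; rewrite ler_pdivlMr // mul1r ler_nat.
have Fj : F x <= j.+1%:R / l%:R.
  by have [/Fj_lt/ltW //|/last_level] := ltnP j.+1 l; lra.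
rewrite ler_norml; apply/andP; split.
  have [j0|j0] := posnP j.
    move: Fj; rewrite jS j0 mul0r add0r => Fj0.
    by rewrite lerBrDr (le_trans _ h0) // addrC subr_le0 (le_trans Fj0) // lerDl.
  have jl' : (0 < j < l)%N by rewrite j0.
  have q := quantile_le (level _ jl') jF.
  have {q}:= h_mono q; have := lo _ jl'; have := le_F_quantile (level _ jl').
  by move: Fj; rewrite jS; lra.
have [jl2|lj] := ltnP j.+1 l; last first.
  by have := last_level lj; have := D0; move: jF; rewrite jS; lra.
have jl' : (0 < j.+1 < l)%N by [].
have q : x < quantile (j.+1%:R / l%:R).
  rewrite ltNge; apply/negP => /F_mono.
  by rewrite leNgt (lt_le_trans (Fj_lt jl2) (le_F_quantile (level _ jl'))).
have {q}:= h_left q; have := up _ jl'; have := F_left_quantile_le (level _ jl').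
by move: jF; rewrite jS; lra.
Qed.

End quantile_grid.

(** * The supremum norm *)

Lemma is_haar_SO_haar_on (R : realType) (n : nat)
    (mu : probability (borel_mx R n) R) :
  is_haar_SO mu -> haar_on 0 mu.
Proof.
move=> [mu1 muU].
have stab0E : (stab 0 : set (borel_mx R n)) = special_orthogonal R n.
  by apply/seteqP; split => S; [exact: stab_SO|exact: stab0].
split; first by rewrite stab0E.
move=> U /stab_SO SOU B mB; rewrite -(muU U^T (SO_tr SOU) B mB); congr (mu _).
have [UU _] := SOU; apply/seteqP; split => [S /= BS|_ [M BM <-] /=].
  by exists (U *m S) => //; rewrite mulmxA (mulmx1C UU) mul1mx.
by rewrite mulmxA UU mul1mx.
Qed.

Definition rational_enum (R : realType) (j : nat) : R :=
  ratr (odflt 0 (unpickle j : option rat)).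

(** The hypothesis is right continuity: every value is approximated by values at
rationals slightly to the right. *)
Lemma sup_norm_rationals (R : realType) (h : R -> R) :
    (forall x e, 0 < e -> exists2 y, x < y &
       forall z, x < z < y -> `|h x - h z| <= e) ->
  sup_norm h = ereal_sup [set (`|h (rational_enum R j)|)%:E | j in [set: nat]].
Proof.
move=> hr; apply/eqP; rewrite eq_le; apply/andP; split; last first.
  apply: ereal_sup_le => _ [j _ <-]; by exists (rational_enum R j).
apply: ge_ereal_sup => _ [x _ <-]; apply/lee_addgt0Pr => e e0.
have [y xy hxy] := hr x e e0.
have /rat_in_itvoo[q] := xy; rewrite in_itv /= => xqy.
have qE : rational_enum R (pickle q) = ratr q by rewrite /rational_enum pickleK.
apply: (@le_trans _ _ ((`|h (ratr q)|)%:E + e%:E)%E).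
  rewrite -EFinD lee_fin -lerBlDl (le_trans _ (hxy _ xqy)) //.
  exact: lerB_dist.
rewrite leeD2r //; apply: ereal_sup_ubound; exists (pickle q) => //.
by rewrite qE.
Qed.

Lemma measurable_sup_norm d (T : measurableType d) (R : realType) (h : T -> R -> R) :
    (forall x, measurable_fun setT (h ^~ x)) ->
    (forall t x e, 0 < e -> exists2 y, x < y &
       forall z, x < z < y -> `|h t x - h t z| <= e) ->
  measurable_fun setT (fun t => sup_norm (h t)).
Proof.
move=> mh hr.
pose u (j : nat) (t : T) : \bar R := (`|h t (rational_enum R j)|)%:E.
have -> : (fun t => sup_norm (h t)) = (fun t => esups (u ^~ t) 0).
  apply/funext => t; rewrite sup_norm_rationals; last exact: hr.
  rewrite /esups /sdrop /=; congr ereal_sup.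
  by apply/seteqP; split => _ [j _ <-]; exists j.
apply: measurable_fun_esups => j; apply/measurable_EFinP.
by apply: measurableT_comp => //; exact: mh.
Qed.

Section spectral_process.
Variables (R : realType) (k n : nat) (k_gt0 : (0 < k)%N) (kn : (k <= n)%N).
Variables (G : 'M[R[i]]_n) (G_herm : G \is hermsymmx).
Variable mu : probability (borel_mx R n) R.
Hypothesis mu_haar : haar_on 0 mu.

Let f := block_cdf kn G.
Let fl := block_cdf_left kn G.
Let F x := mean mu (f x).
Let Fl x := mean mu (fl x).
Let uf x : unit_valued (f x) := block_cdf_unit_valued k_gt0 kn G_herm x.
Let ufl x : unit_valued (fl x) := block_cdf_left_unit_valued k_gt0 kn G_herm x.

Let F_mono : {homo F : x y / x <= y}.
Proof.
move=> x y xy; rewrite -[F y]addr0; apply: (mean_haar_le mu_haar) => // S _.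
by rewrite addr0; exact: block_cdf_mono.
Qed.

Let F_right x : F (x + m.+1%:R^-1) @[m --> \oo] --> F x.
Proof. by apply: mean_cvg => // M; exact: near_block_cdf_right. Qed.

Let F_left x : F (x - m.+1%:R^-1) @[m --> \oo] --> Fl x.
Proof. by apply: mean_cvg => // M; exact: near_block_cdf_left. Qed.

Let F_pinfty : F m%:R @[m --> \oo] --> (1 : R).
Proof.
rewrite -[X in _ --> X](mean_cst mu 1); apply: mean_cvg => //.
  by apply: unit_valued_cst; rewrite ler01 lexx.
by move=> M; exact: near_block_cdf_pinfty.
Qed.

Let F_ninfty : F (- m%:R) @[m --> \oo] --> (0 : R).
Proof.
rewrite -[X in _ --> X](mean_cst mu 0); apply: mean_cvg => //.
  by apply: unit_valued_cst; rewrite ler01 lexx.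
by move=> M; exact: near_block_cdf_ninfty.
Qed.

Let F_unit x : 0 <= F x <= 1.
Proof. by rewrite mean_ge0 // mean_le1. Qed.

Lemma measurable_deviation :
  measurable_fun setT (fun M => sup_norm (fun x => f x M - F x)).
Proof.
apply: measurable_sup_norm => [x|M x e e0].
  by apply: measurable_funB; [case: (uf x)|exact: measurable_cst].
have nf : \forall m \near \oo, f (x + m.+1%:R^-1) M = f x M.
  exact: near_block_cdf_right.
have /cvgrPdist_le/(_ e e0) nF := @F_right x.
have [m [fm Fm]] := filter_ex (filterI nf nF).
exists (x + m.+1%:R^-1); first by rewrite ltrDl invr_gt0.
move=> z /andP[xz zy].
have -> : f z M = f x M.
  apply/eqP; rewrite eq_le (block_cdf_mono kn G M (ltW xz)) andbT -fm.
  exact: (block_cdf_mono kn G M (ltW zy)).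
have -> : f x M - F x - (f x M - F z) = F z - F x by ring.
rewrite ger0_norm ?subr_ge0 ?F_mono ?(ltW xz) //.
apply: le_trans Fm; rewrite distrC (le_trans _ (ler_norm _)) // lerD2r.
exact: F_mono (ltW zy).
Qed.

(** If the deviation exceeds 1/sqrt k + r, then by quantile_grid one of the events
E1 j (a large deficit at a quantile) or E2 j (a large excess just left of it) with
j < l - 1 occurs; the union bound over these 2(l-1) events concludes. *)
Lemma deviation_tail (r : R) : 0 < r ->
  (mu [set M | ((Num.sqrt k%:R)^-1 + r)%R%:E
                  <= sup_norm (fun x : R => f x M - F x)%R]
     <= (12 * Num.sqrt k%:R * expR (- (r * Num.sqrt (k%:R / 32))))%R%:E)%E.
Proof.
move=> r0; set t := Num.sqrt k%:R; set e := expR _.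
have t0 : 0 < t by rewrite sqrtr_gt0 ltr0n.
have [l tl l_min] : exists2 l : nat, t <= l%:R & l.-1%:R < t.
  have ex : exists l : nat, t <= l%:R.
    by exists (Num.bound t); rewrite ltW // archi_boundP // ltW.
  case: (ex_minnP ex) => l tl lmin; exists l => //.
  rewrite ltNge; apply/negP => /lmin.
  have : (0 < l)%N by rewrite -(ltr0n R) (lt_le_trans t0).
  lia.
have l0 : (0 < l)%N by rewrite -(ltr0n R) (lt_le_trans t0).
have l0R : 0 < l%:R :> R by rewrite ltr0n.
pose q (j : nat) := quantile F (j.+1%:R / l%:R).
pose E1 (j : nat) := [set M | f (q j) M <= F (q j) - r].
pose E2 (j : nat) := [set M | Fl (q j) + r <= fl (q j) M].
have mE1 j : measurable (E1 j).
  rewrite -[X in measurable X]setTI.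
  apply: (@measurable_fun_ler _ _ _ setT (f (q j)) (cst (F (q j) - r))) => //.
  by case: (uf (q j)).
have mE2 j : measurable (E2 j).
  rewrite -[X in measurable X]setTI.
  apply: (@measurable_fun_ler _ _ _ setT (cst (Fl (q j) + r)) (fl (q j))) => //.
  by case: (ufl (q j)).
set B := [set M | _].
have mB : measurable B.
  rewrite -[X in measurable X]setTI.
  by apply: emeasurable_fun_c_infty => //; exact: measurable_deviation.
have BE : B `<=` \big[setU/set0]_(j < l.-1) (E1 j `|` E2 j).
  move=> M BM; apply: contrapT => nE.
  have nE1 (j : 'I_l.-1) : F (q j) - f (q j) M < r.
    rewrite ltNge; apply/negP => h; apply: nE.
    rewrite -(bigcup_mkord _ (fun j => E1 j `|` E2 j)).
    by exists (j : nat) => //=; left; rewrite /E1 /=; lra.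
  have nE2 (j : 'I_l.-1) : fl (q j) M - Fl (q j) < r.
    rewrite ltNge; apply/negP => h; apply: nE.
    rewrite -(bigcup_mkord _ (fun j => E1 j `|` E2 j)).
    by exists (j : nat) => //=; right; rewrite /E2 /=; lra.
  pose D := \big[Num.max/0]_(j < l.-1)
    Num.max (F (q j) - f (q j) M) (fl (q j) M - Fl (q j)).
  have Dr : D < r by apply: bigmax_lt => // j _; rewrite gt_max nE1 nE2.
  have D0 : 0 <= D by exact: bigmax_ge_id.
  have leD (j : 'I_l.-1) : F (q j) - f (q j) M <= D /\ fl (q j) M - Fl (q j) <= D.
    by split; apply: le_trans (le_bigmax _ _ j); rewrite le_max lexx ?orbT.
  have grid x : `|f x M - F x| <= l%:R^-1 + D.
    apply: (quantile_grid F_mono F_right F_left F_pinfty F_ninfty F_unit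
      (hl := fun x => fl x M)) => //.
    - by move=> y z; exact: block_cdf_mono.
    - by move=> y; exact: block_cdf_bounds.
    - by move=> y z; exact: block_cdf_lt_left.
    - move=> j /andP[j0 jl]; have jl' : (j.-1 < l.-1)%N by lia.
      by have [+ _] := leD (Ordinal jl'); rewrite /q /= prednK.
    - move=> j /andP[j0 jl]; have jl' : (j.-1 < l.-1)%N by lia.
      by have [_ +] := leD (Ordinal jl'); rewrite /q /= prednK.
  have : (sup_norm (fun x => f x M - F x)%R <= (l%:R^-1 + D)%:E)%E.
    by apply: ge_ereal_sup => _ [x _ <-]; rewrite lee_fin.
  move=> /(le_trans BM); rewrite lee_fin leNgt => /negP; apply.
  by apply: ler_ltD => //; rewrite lef_pV2 ?posrE.
apply: (@le_trans _ _ (mu (\big[setU/set0]_(j < l.-1) (E1 j `|` E2 j)))).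
  apply: le_measure; rewrite ?inE //.
  by apply: bigsetU_measurable => j _; exact: measurableU.
have boole := @Boole_inequality _ _ _ mu (fun j => E1 j `|` E2 j) l.-1
  (fun j _ => measurableU _ _ (mE1 j) (mE2 j)).
apply: le_trans boole _.
apply: (@le_trans _ _ (\sum_(j < l.-1) (8 * e)%:E)%E).
  apply: lee_sum => j _; apply: le_trans (measureU2 _ _ _) _ => //.
  have [_ t1] := block_tails k_gt0 r mu_haar (block_cdf_admissible k_gt0 kn G_herm (q j)).
  have [t2 _] := block_tails k_gt0 r mu_haar (block_cdf_left_admissible k_gt0 kn G_herm (q j)).
  apply: le_trans (leeD t1 t2) _; rewrite -EFinD lee_fin -/e; lra.
rewrite sumEFin lee_fin sumr_const card_ord -[leLHS]mulr_natl mulrA.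
rewrite ler_wpM2r ?expR_ge0 //; lra.
Qed.

End spectral_process.

Theorem theorem4p1 (R : realType) (k n : nat) (k_gt0 : (1 <= k)%N)
    (kn : (k <= n)%N) (G : 'M[R[i]]_n) (G_herm : G \is hermsymmx)
    (d : measure_display) (Omega : measurableType d) (P : probability Omega R)
    (X : {RV P >-> borel_mx R n}) (X_haar : is_haar_SO (distribution P X)) :
  let A : Omega -> 'M[R[i]]_k :=
    fun w => principal_submx kn (conjugated_mx G (X w)) in
  let F : R -> R := fun x => fine ('E_P[fun w => spectral_cdf (A w) x])%E in
  forall r : R, 0 < r ->
    (P [set w | ((Num.sqrt k%:R)^-1 + r)%R%:E
                  <= sup_norm (fun x : R => spectral_cdf (A w) x - F x)%R]
     <= (12 * Num.sqrt k%:R * expR (- (r * Num.sqrt (k%:R / 32))))%R%:E)%E.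
Proof.
move=> A F r r0.
have FE : F = (fun x => mean (distribution P X) (block_cdf kn G x)).
  apply/funext => x; have [mf f01] := block_cdf_unit_valued k_gt0 kn G_herm x.
  rewrite /F /mean unlock ge0_integral_distribution //.
    exact/measurable_EFinP.
  by move=> M; rewrite lee_fin; case/andP: (f01 M).
have distE (B : set (borel_mx R n)) :
  (distribution P X : probability (borel_mx R n) R) B = P (X @^-1` B) by [].
have := deviation_tail k_gt0 kn G_herm (is_haar_SO_haar_on X_haar) r0.
rewrite distE FE.
exact.
Qed.
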